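(* Let $n$ be a positive integer and let $z$ be a real number with $0<|z|\le 1$. Then \[ \sum_{k=1}^\infty \frac{\zeta(2k)z^{2k}}{k(k+n)} = -\frac{1}{2n^2}+\frac{\ln(2\pi z)}{n}+\frac{(-1)^n\,2(2n-1)!}{(2\pi z)^{2n}}\zeta(2n+1) -2(2n-1)!\sum_{j=1}^{n}(-1)^j\frac{(2n+1-2j)\operatorname{Cl}_{2j+1}(2\pi z)+2\pi z\operatorname{Cl}_{2j}(2\pi z)}{(2n+1-2j)!\,(2\pi z)^{2j}}, \] and \[ \sum_{k=1}^\infty \frac{\zeta(2k)z^{2k}}{k(2k-1+2n)} = -\frac{1}{(2n-1)^2}+\frac{\ln\big(\pi z\csc(\pi z)\big)}{2n-1} -(2n-2)!\sum_{j=1}^{n}(-1)^j\frac{(2n+1-2j)\operatorname{Cl}_{2j}(2\pi z)-2\pi z\operatorname{Cl}_{2j-1}(2\pi z)}{(2n+1-2j)!\,(2\pi z)^{2j-1}}. \]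
   Context: $\zeta$ is the Riemann zeta function. The Clausen functions are $\operatorname{Cl}_1(x)=-\ln(2\sin(x/2))$ and, for $n\ge2$, $\operatorname{Cl}_n(x)=\sum_{k\ge1}\sin(kx)/k^n$ if $n$ is even and $\operatorname{Cl}_n(x)=\sum_{k\ge1}\cos(kx)/k^n$ if $n$ is odd.
   Formalization: For negative z, ln(2πz) is read as ln|2πz| and Cl_1(x) as −ln|2 sin(x/2)|, the originals being undefined there; the second identity is stated only for 0<|z|<1, since csc(πz) and Cl_1(2πz) are undefined at |z|=1. *)

(* Defs.v *)
From Stdlib Require Import Reals Factorial.
From Coquelicot Require Import Coquelicot.
Open Scope R_scope.

(* Riemann zeta at an integer s >= 2 : zeta s = sum_{m>=1} 1/m^s.
   (Only used at s >= 2, where the series converges.) *)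
Definition zeta (s : nat) : R :=
  Series (fun m : nat => / (INR (m + 1)) ^ s).

(* Clausen functions.
   Cl_1 x = -ln|2 sin(x/2)|  (= -ln(2 sin(x/2)) on 0 < x < 2 pi, and equal to
   sum cos(kx)/k for all x not in 2 pi Z);
   for n >= 2: sum_{k>=1} sin(kx)/k^n (n even), sum_{k>=1} cos(kx)/k^n (n odd). *)
Definition Cl (n : nat) (x : R) : R :=
  match n with
  | O => 0 (* not used *)
  | 1%nat => - ln (Rabs (2 * sin (x / 2)))
  | _ => if Nat.even n
         then Series (fun k : nat => sin (INR (k + 1) * x) / (INR (k + 1)) ^ n)
         else Series (fun k : nat => cos (INR (k + 1) * x) / (INR (k + 1)) ^ n)
  end.

(* Main.v *)
(* On 0 < z < 1 Euler's sine product gives sum_k zeta(2k) z^(2k) / k = ln (pi z / sin (pi z)),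
   which is ln x + Cl_1(x) with x = 2 pi z. Both series of the theorem have the form
   sum_k zeta(2k) z^(2k) / (k (2k + p)), that is, z^(-p) times the integral of
   t^(p-1) (ln (2 pi t) + Cl_1 (2 pi t)) over [0, z], with p = 2n or p = 2n - 1.
   Repeated integration by parts with Cl_(2j)' = Cl_(2j-1) and Cl_(2j+1)' = - Cl_(2j)
   evaluates this integral; the point z = 1 follows by monotone convergence and
   negative z by parity.

   The sine product comes from the integrals of cos^n t cos (2 z t) over [0, pi/2],
   and Cl_2' = Cl_1 from Abel summation of the series sum_k r^k cos (k x) / k. *)

Require Import Defs.
From Stdlib Require Import Reals Factorial.
From Coquelicot Require Import Coquelicot.
From Stdlib Require Import Lra Lia PSeries_reg.
Open Scope R_scope.

(** * Series of functions *)

Lemma sum_n_succ (a : nat -> R) (n : nat) : sum_n a (S n) = sum_n a n + a (S n).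
Proof. exact (sum_Sn a n). Qed.

Lemma sum_n_zero (a : nat -> R) : sum_n a 0 = a 0%nat.
Proof. exact (sum_O a). Qed.

Lemma is_series_lim (a : nat -> R) (l : R) : is_series a l <-> is_lim_seq (sum_n a) l.
Proof. split; intros H; exact H. Qed.

Lemma is_series_ext_R (a b : nat -> R) (l : R) :
  is_series a l -> (forall k, a k = b k) -> is_series b l.
Proof. intros Ha H; exact (is_series_ext a b l H Ha). Qed.

Lemma is_series_scal_R (c : R) (a : nat -> R) (l : R) :
  is_series a l -> is_series (fun k => c * a k) (c * l).
Proof. exact (is_series_scal c a l). Qed.

Lemma ex_series_le_R (a M : nat -> R) :
  (forall k, Rabs (a k) <= M k) -> ex_series M -> ex_series a.
Proof.
intros H HM; exact (@ex_series_le R_AbsRing R_CompleteNormedModule a M H HM).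
Qed.

Lemma Series_tail_le (a M : nat -> R) (n : nat) :
  (forall k, Rabs (a k) <= M k) -> ex_series M ->
  Rabs (Series a - sum_n a n) <= Series M - sum_n M n.
Proof.
intros H HM.
assert (Ha := ex_series_le_R a M H HM).
rewrite (Series_incr_n a (S n)), (Series_incr_n M (S n)) by (auto; lia).
rewrite !sum_n_Reals; simpl pred.
match goal with |- Rabs ?x <= ?y =>
  replace x with (Series (fun k => a (S n + k)%nat)) by ring;
  replace y with (Series (fun k => M (S n + k)%nat)) by ring end.
assert (HM' : ex_series (fun k => M (S n + k)%nat))
  by (apply (ex_series_incr_n M (S n)); exact HM).
eapply Rle_trans; [apply Series_Rabs|apply Series_le; auto].
- apply ex_series_le_R with (fun k => M (S n + k)%nat); auto.
  intros k; rewrite Rabs_Rabsolu; auto.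
- intros k; split; [apply Rabs_pos|auto].
Qed.

Lemma CVU_Series (f : nat -> R -> R) (M : nat -> R) (x : R) (r : posreal) :
  (forall k y, Rabs (f k y) <= M k) -> ex_series M ->
  CVU (fun n y => sum_n (fun k => f k y) n) (fun y => Series (fun k => f k y)) x r.
Proof.
intros H HM eps Heps.
assert (HS : is_lim_seq (sum_n M) (Series M)) by exact (Series_correct M HM).
apply is_lim_seq_spec in HS.
destruct (HS (mkposreal eps Heps)) as [N HN]; simpl in HN.
exists N; intros n y Hn _.
eapply Rle_lt_trans; [apply Series_tail_le; eauto|].
specialize (HN n Hn); revert HN; unfold Rabs; destruct Rcase_abs; lra.
Qed.

Lemma continuity_pt_sum_n (f : nat -> R -> R) (n : nat) (x : R) :
  (forall k, continuity_pt (f k) x) ->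
  continuity_pt (fun y => sum_n (fun k => f k y) n) x.
Proof.
intros H; induction n as [|n IH].
- apply continuity_pt_ext with (f 0%nat); auto.
  intros y; now rewrite sum_n_zero.
- apply continuity_pt_ext with (fun y => sum_n (fun k => f k y) n + f (S n) y).
  + intros y; now rewrite sum_Sn.
  + now apply (continuity_pt_plus (fun y => sum_n (fun k => f k y) n)).
Qed.

Lemma continuity_pt_Series (f : nat -> R -> R) (M : nat -> R) (x : R) :
  (forall k y, Rabs (f k y) <= M k) -> ex_series M ->
  (forall k y, continuity_pt (f k) y) ->
  continuity_pt (fun y => Series (fun k => f k y)) x.
Proof.
intros H HM Hc.
apply (CVU_continuity _ _ x (mkposreal 1 Rlt_0_1)
         (CVU_Series f M x (mkposreal 1 Rlt_0_1) H HM)).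
- intros n y _; now apply continuity_pt_sum_n.
- unfold Boule; simpl; rewrite Rminus_diag, Rabs_R0; lra.
Qed.

Lemma is_derive_ext_R (f g : R -> R) (x l : R) :
  (forall y, f y = g y) -> is_derive f x l -> is_derive g x l.
Proof. intros H; exact (is_derive_ext f g x l H). Qed.

Lemma is_derive_CVU (fn fn' : nat -> R -> R) (f g : R -> R) (x : R) (r : posreal) :
  (forall n y, Boule x r y -> is_derive (fn n) y (fn' n y)) ->
  (forall y, Boule x r y -> is_lim_seq (fun n => fn n y) (f y)) ->
  CVU fn' g x r ->
  is_derive f x (g x).
Proof.
intros Hd Hl Hu.
apply is_derive_Reals, (CVU_derivable fn fn' f g x r Hu).
- intros y Hy; apply is_lim_seq_Reals; auto.
- intros n y Hy; apply is_derive_Reals; auto.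
- unfold Boule; rewrite Rminus_diag, Rabs_R0; apply cond_pos.
Qed.

Lemma is_derive_Series (f g : nat -> R -> R) (M : nat -> R) (x : R) :
  (forall k y, is_derive (f k) y (g k y)) ->
  (forall k y, Rabs (g k y) <= M k) -> ex_series M ->
  (forall y, ex_series (fun k => f k y)) ->
  is_derive (fun y => Series (fun k => f k y)) x (Series (fun k => g k x)).
Proof.
intros Hd Hg HM Hf.
apply (is_derive_CVU (fun n y => sum_n (fun k => f k y) n)
         (fun n y => sum_n (fun k => g k y) n) _
         (fun y => Series (fun k => g k y)) x (mkposreal 1 Rlt_0_1)).
- intros n y _; apply (is_derive_sum_n (fun k y => f k y)); auto.
- intros y _; apply (Series_correct (fun k => f k y)); auto.
- now apply CVU_Series with M.
Qed.


Lemma cos_rec (x : R) (n : nat) :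
  cos (INR (S (S n)) * x) = 2 * cos x * cos (INR (S n) * x) - cos (INR n * x).
Proof.
replace (INR (S (S n)) * x) with (INR (S n) * x + x) by (rewrite (S_INR (S n)); ring).
replace (INR n * x) with (INR (S n) * x - x) by (rewrite (S_INR n); ring).
rewrite cos_plus, cos_minus; ring.
Qed.

Lemma quad_pos (r x : R) : Rabs r < 1 -> 0 < 1 - 2 * r * cos x + r ^ 2.
Proof.
intros Hr; apply Rabs_def2 in Hr.
assert (H := COS_bound x).
destruct (Rle_dec 0 r).
- replace (1 - 2 * r * cos x + r ^ 2) with ((1 - r) ^ 2 + 2 * (r * (1 - cos x))) by ring; nra.
- replace (1 - 2 * r * cos x + r ^ 2) with ((1 + r) ^ 2 + 2 * (- r * (1 + cos x))) by ring; nra.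
Qed.

Lemma is_series_pow_cos (r x : R) :
  Rabs r < 1 ->
  is_series (fun k => r ^ k * cos (INR (S k) * x))
    ((cos x - r) / (1 - 2 * r * cos x + r ^ 2)).
Proof.
intros Hr; set (D := 1 - 2 * r * cos x + r ^ 2).
assert (HD : 0 < D) by now apply quad_pos.
assert (Hs : forall n, sum_n (fun k => r ^ k * cos (INR (S k) * x)) n =
   (cos x - r) / D - (r ^ S n * cos (INR (S (S n)) * x)
                      - r ^ S (S n) * cos (INR (S n) * x)) / D).
{ intros n; apply Rmult_eq_reg_r with D; [|lra].
  transitivity (cos x - r - (r ^ S n * cos (INR (S (S n)) * x)
                             - r ^ S (S n) * cos (INR (S n) * x))); [|field; lra].
  induction n as [|n IH].
  - rewrite sum_n_zero, cos_rec; simpl; rewrite Rmult_0_l, cos_0, !Rmult_1_l; unfold D; ring.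
  - rewrite sum_n_succ.
    rewrite Rmult_plus_distr_r, IH, (cos_rec x (S n)); unfold D; simpl; ring. }
apply is_series_lim, (is_lim_seq_ext _ _ _ (fun n => eq_sym (Hs n))).
replace (Finite ((cos x - r) / D)) with (Finite ((cos x - r) / D - 0 / D)) by
  (f_equal; field; lra).
assert (Hp : forall (i j : nat), is_lim_seq (fun n => r ^ (i + n) * cos (INR (j + n) * x)) 0).
{ intros i j.
  apply is_lim_seq_abs_0.
  apply is_lim_seq_le_le with (fun _ => 0) (fun n => Rabs (r ^ (n + i))).
  - intros n; split; [apply Rabs_pos|].
    rewrite Rabs_mult, (Nat.add_comm n i).
    assert (H := COS_bound (INR (j + n) * x)).
    rewrite <- (Rmult_1_r (Rabs (r ^ _))) at 2.
    apply Rmult_le_compat_l; [apply Rabs_pos|apply Rabs_le; lra].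
  - apply is_lim_seq_const.
  - apply -> (is_lim_seq_incr_n (fun n => Rabs (r ^ n)) i).
    apply -> (is_lim_seq_abs_0 (fun n => r ^ n)).
    now apply is_lim_seq_geom. }
apply is_lim_seq_minus'; [apply is_lim_seq_const|].
apply is_lim_seq_mult'; [|apply is_lim_seq_const].
replace 0 with (0 - 0) by ring.
apply is_lim_seq_minus'; [apply (Hp 1%nat 2%nat)|apply (Hp 2%nat 1%nat)].
Qed.

Lemma CV_radius_ge_1 (a : nat -> R) (r : R) :
  (forall k, Rabs (a k) <= 1) -> Rabs r < 1 -> Rbar_lt (Rabs r) (CV_radius a).
Proof.
intros Ha Hr.
apply Rbar_lt_le_trans with 1; [exact Hr|].
apply CV_radius_bounded; exists 1; intros n; rewrite pow1, Rmult_1_r; auto.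
Qed.

Lemma is_series_ln_cos (r x : R) :
  Rabs r < 1 ->
  is_series (fun k => r ^ S k * cos (INR (S k) * x) / INR (S k))
    (- / 2 * ln (1 - 2 * r * cos x + r ^ 2)).
Proof.
intros Hr.
set (a := fun k => match k with O => 0 | S _ => cos (INR k * x) / INR k end).
assert (Ha : forall k, Rabs (a k) <= 1).
{ intros [|k]; unfold a; [rewrite Rabs_R0; lra|].
  unfold Rdiv; rewrite Rabs_mult.
  assert (H := COS_bound (INR (S k) * x)).
  assert (H1 : 1 <= INR (S k)) by (rewrite S_INR; generalize (pos_INR k); lra).
  rewrite <- (Rmult_1_l 1); apply Rmult_le_compat; try apply Rabs_pos.
  - apply Rabs_le; lra.
  - rewrite Rabs_inv, Rabs_pos_eq by lra.
    rewrite <- Rinv_1; apply Rinv_le_contravar; lra. }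
assert (Hd : forall t, Rabs t < 1 ->
  is_derive (fun y => PSeries a y + / 2 * ln (1 - 2 * y * cos x + y ^ 2)) t 0).
{ intros t Ht.
  assert (HD := quad_pos t x Ht).
  replace 0 with (PSeries (PS_derive a) t + / 2 * ((- (2 * cos x) + 2 * t) / (1 - 2 * t * cos x + t ^ 2))).
  - apply @is_derive_plus.
    + apply is_derive_PSeries; now apply CV_radius_ge_1.
    + auto_derive; [simpl in HD; lra|simpl; field; simpl in HD; lra].
  - assert (E : PSeries (PS_derive a) t = (cos x - t) / (1 - 2 * t * cos x + t ^ 2)).
    { unfold PSeries; rewrite <- (is_series_unique _ _ (is_series_pow_cos t x Ht)).
      apply Series_ext; intros k; unfold PS_derive, a; field.
      apply not_0_INR; lia. }
    rewrite E; field; lra. }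
assert (E : PSeries a r = - / 2 * ln (1 - 2 * r * cos x + r ^ 2)).
{ destruct (MVT_gen (fun y => PSeries a y + / 2 * ln (1 - 2 * y * cos x + y ^ 2)) 0 r (fun _ => 0))
    as [c [_ Hc]].
  - intros t Ht; apply Hd.
    revert Ht Hr; unfold Rmin, Rmax; destruct Rle_dec; intros;
    apply Rabs_def1; apply Rabs_def2 in Hr; lra.
  - intros t Ht; apply derivable_continuous_pt; exists 0; apply is_derive_Reals, Hd.
    revert Ht Hr; unfold Rmin, Rmax; destruct Rle_dec; intros;
    apply Rabs_def1; apply Rabs_def2 in Hr; lra.
  - rewrite PSeries_0 in Hc; simpl a in Hc.
    replace (1 - 2 * 0 * cos x + 0 ^ 2) with 1 in Hc by ring.
    rewrite ln_1 in Hc; lra. }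
rewrite <- E.
assert (Hex : ex_series (fun k => a k * r ^ k)).
{ apply ex_pseries_R, CV_radius_inside; now apply CV_radius_ge_1. }
apply is_series_ext_R with (fun k => a (S k) * r ^ S k).
- apply (is_series_incr_1 (fun k => a k * r ^ k)).
  replace (plus (PSeries a r) _) with (PSeries a r).
  + apply Series_correct; exact Hex.
  + unfold plus; simpl; rewrite Rmult_0_l, Rplus_0_r; reflexivity.
- intros k; unfold a; field; apply not_0_INR; lia.
Qed.

Lemma is_series_ln (u : R) :
  Rabs u < 1 -> is_series (fun k => u ^ S k / INR (S k)) (- ln (1 - u)).
Proof.
intros Hu.
assert (H1 : 0 < 1 - u) by (apply Rabs_def2 in Hu; lra).
replace (- ln (1 - u)) with (- / 2 * ln (1 - 2 * u * cos 0 + u ^ 2)).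
- apply (is_series_ext_R _ _ _ (is_series_ln_cos u 0 Hu)).
  intros k; rewrite Rmult_0_r, cos_0, Rmult_1_r; reflexivity.
- rewrite cos_0; replace (1 - 2 * u * 1 + u ^ 2) with ((1 - u) * (1 - u)) by ring.
  rewrite ln_mult by lra; field.
Qed.

(** * Derivatives of the Clausen functions *)

Lemma INR_succ_ge_1 (k : nat) : 1 <= INR (k + 1).
Proof. rewrite plus_INR; simpl; generalize (pos_INR k); lra. Qed.

Lemma is_lim_seq_inv_INR : is_lim_seq (fun n => / INR (n + 1)) 0.
Proof.
replace (Finite 0) with (Rbar_inv p_infty) by reflexivity.
apply is_lim_seq_inv; [|discriminate].
apply (is_lim_seq_incr_n INR 1), is_lim_seq_INR.
Qed.

Lemma ex_series_inv_pow (m : nat) :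
  (2 <= m)%nat -> ex_series (fun k => / INR (k + 1) ^ m).
Proof.
intros Hm.
assert (H2 : ex_series (fun k => / INR (k + 1) ^ 2)).
{ assert (Hb : forall n, sum_n (fun k => / INR (k + 1) ^ 2) n <= 2 - / INR (n + 1)).
  { induction n as [|n IH].
    - rewrite sum_n_zero; simpl; lra.
    - rewrite sum_n_succ.
      assert (H := INR_succ_ge_1 n).
      replace (INR (S n + 1)) with (INR (n + 1) + 1)
        by (rewrite (plus_INR (S n)), S_INR, plus_INR; simpl; ring).
      revert IH; generalize (INR (n + 1)) H; clear; intros t Ht.
      assert (0 <= / t - / (t + 1) - / (t + 1) ^ 2).
      { replace (/ t - / (t + 1) - / (t + 1) ^ 2) with (/ (t * (t + 1) ^ 2)) by (field; lra).
        apply Rlt_le, Rinv_0_lt_compat; nra. }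
      lra. }
  destruct (ex_finite_lim_seq_incr (sum_n (fun k => / INR (k + 1) ^ 2)) 2) as [l Hl].
  - intros n; rewrite sum_n_succ.
    enough (0 < / INR (S n + 1) ^ 2) by lra.
    apply Rinv_0_lt_compat, pow_lt; generalize (INR_succ_ge_1 (S n)); lra.
  - intros n; eapply Rle_trans; [apply Hb|].
    enough (0 < / INR (n + 1)) by lra.
    apply Rinv_0_lt_compat; generalize (INR_succ_ge_1 n); lra.
  - exists l; exact Hl. }
apply ex_series_le_R with (2 := H2); intros k.
assert (H := INR_succ_ge_1 k).
rewrite Rabs_inv, Rabs_pos_eq by (apply pow_le; lra).
apply Rinv_le_contravar; [apply pow_lt; lra|].
now apply Rle_pow.
Qed.

Definition trig (i : nat) (x : R) : R := if Nat.even i then sin x else cos x.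

Lemma Rabs_trig (i : nat) (x : R) : Rabs (trig i x) <= 1.
Proof.
unfold trig; apply Rabs_le; destruct Nat.even.
- generalize (SIN_bound x); lra.
- generalize (COS_bound x); lra.
Qed.

Lemma is_derive_trig (i : nat) (x : R) :
  is_derive (trig (S i)) x ((-1) ^ S i * trig i x).
Proof.
unfold trig; rewrite Nat.even_succ, <- Nat.negb_even.
destruct (Nat.even i) eqn:E; simpl negb; cbv iota.
- apply Nat.even_spec in E; destruct E as [j ->].
  rewrite pow_1_odd; auto_derive; auto; ring.
- assert (Ho : Nat.odd i = true) by now rewrite <- Nat.negb_even, E.
  apply Nat.odd_spec in Ho; destruct Ho as [j ->].
  replace (S (2 * j + 1)) with (2 * (S j))%nat by lia.
  rewrite pow_1_even; auto_derive; auto; ring.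
Qed.

Lemma Cl_trig (i : nat) (x : R) :
  Cl (S (S i)) x = Series (fun k => trig i (INR (k + 1) * x) / INR (k + 1) ^ S (S i)).
Proof. unfold Cl, trig; simpl Nat.even; destruct Nat.even; reflexivity. Qed.

Lemma Rabs_trig_term (i k m : nat) (x : R) :
  Rabs (trig i (INR (k + 1) * x) / INR (k + 1) ^ m) <= / INR (k + 1) ^ m.
Proof.
assert (H := INR_succ_ge_1 k).
assert (Hp : 0 < / INR (k + 1) ^ m) by (apply Rinv_0_lt_compat, pow_lt; lra).
unfold Rdiv; rewrite Rabs_mult, (Rabs_pos_eq (/ _)) by lra.
generalize (Rabs_trig i (INR (k + 1) * x)); nra.
Qed.

Lemma is_derive_Cl (i : nat) (x : R) :
  is_derive (Cl (S (S (S i)))) x ((-1) ^ S i * Cl (S (S i)) x).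
Proof.
rewrite Cl_trig, <- Series_scal_l.
apply is_derive_ext_R with
  (fun y => Series (fun k => trig (S i) (INR (k + 1) * y) / INR (k + 1) ^ S (S (S i)))).
{ intros y; symmetry; apply Cl_trig. }
apply (is_derive_Series
  (fun k y => trig (S i) (INR (k + 1) * y) / INR (k + 1) ^ S (S (S i)))
  (fun k y => (-1) ^ S i * (trig i (INR (k + 1) * y) / INR (k + 1) ^ S (S i)))
  (fun k => / INR (k + 1) ^ S (S i))).
- intros k y.
  assert (H := INR_succ_ge_1 k).
  replace ((-1) ^ S i * (trig i (INR (k + 1) * y) / INR (k + 1) ^ S (S i)))
    with (/ INR (k + 1) ^ S (S (S i)) * (INR (k + 1) * ((-1) ^ S i * trig i (INR (k + 1) * y)))).
  2: { simpl; field; repeat split; try lra; apply pow_nonzero; lra. }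
  apply is_derive_ext_R with
    (fun y => / INR (k + 1) ^ S (S (S i)) * trig (S i) (INR (k + 1) * y)).
  { intros t; apply Rmult_comm. }
  apply @is_derive_scal.
  apply (is_derive_comp (trig (S i)) (fun y => INR (k + 1) * y)).
  + apply is_derive_trig.
  + auto_derive; auto; ring.
- intros k y; rewrite Rabs_mult, pow_1_abs, Rmult_1_l; apply Rabs_trig_term.
- apply ex_series_inv_pow; lia.
- intros y; apply ex_series_le_R with (fun k => / INR (k + 1) ^ S (S (S i))).
  + intros k; apply Rabs_trig_term.
  + apply ex_series_inv_pow; lia.
Qed.

Lemma continuity_pt_is_derive (f : R -> R) (x l : R) :
  is_derive f x l -> continuity_pt f x.
Proof.
intros H; apply derivable_continuous_pt; exists l; now apply is_derive_Reals.
Qed.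

Lemma continuity_pt_Cl (i : nat) (x : R) : continuity_pt (Cl (S (S i))) x.
Proof.
apply continuity_pt_ext with
  (fun y => Series (fun k => trig i (INR (k + 1) * y) / INR (k + 1) ^ S (S i))).
{ intros y; symmetry; apply Cl_trig. }
apply (continuity_pt_Series
  (fun k y => trig i (INR (k + 1) * y) / INR (k + 1) ^ S (S i))
  (fun k => / INR (k + 1) ^ S (S i))).
- intros k y; apply Rabs_trig_term.
- apply ex_series_inv_pow; lia.
- intros k y; assert (H := INR_succ_ge_1 k).
  generalize (INR (k + 1) ^ S (S i)); intros D.
  unfold trig; destruct Nat.even;
  apply derivable_continuous_pt, ex_derive_Reals_0; auto_derive; auto.
Qed.

Lemma ln_lipschitz (m a b : R) :
  0 < m -> m <= a -> m <= b -> Rabs (ln a - ln b) <= Rabs (a - b) / m.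
Proof.
intros Hm Ha Hb.
assert (K : forall a b, m <= a -> m <= b -> ln a - ln b <= Rabs (a - b) / m).
{ clear a b Ha Hb; intros a b Ha Hb.
  assert (H := exp_ineq1_le (ln (a / b))).
  rewrite exp_ln in H by (apply Rdiv_lt_0_compat; lra).
  rewrite ln_div in H by lra.
  apply Rle_trans with ((a - b) / b).
  - replace ((a - b) / b) with (a / b - 1) by (field; lra); lra.
  - unfold Rdiv; apply Rle_trans with (Rabs (a - b) * / b).
    + apply Rmult_le_compat_r; [apply Rlt_le, Rinv_0_lt_compat; lra|apply Rle_abs].
    + apply Rmult_le_compat_l; [apply Rabs_pos|apply Rinv_le_contravar; lra]. }
assert (H1 := K a b Ha Hb); assert (H2 := K b a Hb Ha).
rewrite Rabs_minus_sym in H2.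
apply Rabs_le; lra.
Qed.

(* Abel means of the series [Cl 2]; [r] tends to 1 along [r = 1 / (1 + t^2)],
   a parametrization on which the Weierstrass test applies for all real [t]. *)
Definition Cl2_abel (r y : R) : R :=
  Series (fun k => r ^ S k * sin (INR (k + 1) * y) / INR (k + 1) ^ 2).

Lemma is_derive_Cl2_abel (r y : R) :
  0 <= r < 1 -> is_derive (Cl2_abel r) y (- / 2 * ln (1 - 2 * r * cos y + r ^ 2)).
Proof.
intros Hr.
assert (Hr' : Rabs r < 1) by (rewrite Rabs_pos_eq; lra).
rewrite <- (is_series_unique _ _ (is_series_ln_cos r y Hr')).
apply (is_derive_Series
  (fun k y => r ^ S k * sin (INR (k + 1) * y) / INR (k + 1) ^ 2)
  (fun k y => r ^ S k * cos (INR (S k) * y) / INR (S k)) (fun k => r ^ S k)).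
- intros k t; assert (H := INR_succ_ge_1 k).
  replace (S k) with (k + 1)%nat by lia.
  auto_derive; auto; field; lra.
- intros k t; unfold Rdiv; rewrite Rmult_assoc, Rabs_mult.
  assert (H := INR_succ_ge_1 k).
  rewrite Rabs_pos_eq by (apply pow_le; lra).
  rewrite <- (Rmult_1_r (r ^ S k)) at 2.
  apply Rmult_le_compat_l; [apply pow_le; lra|].
  replace (S k) with (k + 1)%nat by lia.
  assert (Hi : 0 < / INR (k + 1) <= 1).
  { split; [apply Rinv_0_lt_compat; lra|rewrite <- Rinv_1; apply Rinv_le_contravar; lra]. }
  generalize (COS_bound (INR (k + 1) * t)); intros; apply Rabs_le; nra.
- apply (ex_series_incr_1 (fun k => r ^ k)), ex_series_geom; exact Hr'.
- intros t; apply ex_series_le_R with (fun k => / INR (k + 1) ^ 2).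
  + intros k; unfold Rdiv; rewrite Rmult_assoc, Rabs_mult.
    rewrite <- (Rmult_1_l (/ _)).
    apply Rmult_le_compat; try apply Rabs_pos.
    * rewrite Rabs_pos_eq by (apply pow_le; lra).
      apply Rle_trans with (1 ^ S k); [apply pow_incr; lra|rewrite pow1; lra].
    * rewrite Rmult_1_l; apply (Rabs_trig_term 0).
  + apply ex_series_inv_pow; lia.
Qed.

Lemma is_lim_seq_Cl2_abel (y : R) :
  is_lim_seq (fun n => Cl2_abel (/ (1 + (/ INR (n + 1)) ^ 2)) y) (Cl 2 y).
Proof.
replace (Cl 2 y) with (Cl2_abel (/ (1 + 0 ^ 2)) y).
- apply (is_lim_seq_continuous (fun t => Cl2_abel (/ (1 + t ^ 2)) y) (fun n => / INR (n + 1))).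
  + apply (continuity_pt_Series
     (fun k t => (/ (1 + t ^ 2)) ^ S k * sin (INR (k + 1) * y) / INR (k + 1) ^ 2)
     (fun k => / INR (k + 1) ^ 2)).
    * intros k t; unfold Rdiv; rewrite Rmult_assoc, Rabs_mult.
      assert (Ht : 0 < / (1 + t ^ 2) <= 1).
      { split; [apply Rinv_0_lt_compat; nra|rewrite <- Rinv_1; apply Rinv_le_contravar; nra]. }
      rewrite <- (Rmult_1_l (/ INR _ ^ 2)).
      apply Rmult_le_compat; try apply Rabs_pos.
      -- rewrite Rabs_pos_eq by (apply pow_le; lra).
         apply Rle_trans with (1 ^ S k); [apply pow_incr; lra|rewrite pow1; lra].
      -- rewrite Rmult_1_l; apply (Rabs_trig_term 0).
    * apply ex_series_inv_pow; lia.
    * intros k t; apply derivable_continuous_pt, ex_derive_Reals_0.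
      generalize (INR (k + 1) ^ 2) (sin (INR (k + 1) * y)); intros D c.
      auto_derive; repeat split; auto; apply Rgt_not_eq; nra.
  + apply is_lim_seq_inv_INR.
- replace (1 + 0 ^ 2) with 1 by ring; rewrite Rinv_1.
  apply Series_ext; intros k; rewrite pow1, Rmult_1_l; reflexivity.
Qed.

Lemma Cl_1_sin2 (y : R) :
  sin (y / 2) <> 0 -> Cl 1 y = - / 2 * ln (4 * sin (y / 2) ^ 2).
Proof.
intros Hy; unfold Cl.
assert (H2 : 2 * sin (y / 2) <> 0) by lra.
replace (4 * sin (y / 2) ^ 2) with (Rabs (2 * sin (y / 2)) * Rabs (2 * sin (y / 2))).
- rewrite ln_mult by now apply Rabs_pos_lt. field.
- rewrite <- Rabs_mult, Rabs_pos_eq by apply Rle_0_sqr; ring.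
Qed.

Lemma is_derive_Cl_2 (x : R) : sin (x / 2) <> 0 -> is_derive (Cl 2) x (Cl 1 x).
Proof.
intros Hx.
assert (Hs0 : 0 < sin (x / 2) ^ 2) by (apply pow2_gt_0; exact Hx).
set (s := sin (x / 2) ^ 2 / 2); assert (Hs : 0 < s) by (unfold s; lra).
assert (Hc : continuity_pt (fun y => sin (y / 2) ^ 2) x).
{ apply derivable_continuous_pt, ex_derive_Reals_0; auto_derive; auto. }
destruct (Hc s Hs) as [e [He Hball]].
assert (HS : forall y, Boule x (mkposreal e He) y -> s <= sin (y / 2) ^ 2).
{ intros y Hy; unfold Boule in Hy; simpl in Hy.
  destruct (Req_dec x y) as [<-|Hxy]; [unfold s; lra|].
  assert (H := Hball y (conj (conj I Hxy) Hy)).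
  apply Rabs_def2 in H; simpl in H; simpl; unfold s in *; simpl in *; lra. }
apply (is_derive_CVU
  (fun n y => Cl2_abel (/ (1 + (/ INR (n + 1)) ^ 2)) y)
  (fun n y => let r := / (1 + (/ INR (n + 1)) ^ 2) in - / 2 * ln (1 - 2 * r * cos y + r ^ 2))
  (Cl 2) (Cl 1) x (mkposreal e He)).
- intros n y _; apply is_derive_Cl2_abel.
  assert (H := INR_succ_ge_1 n).
  assert (Ht : 0 < / INR (n + 1)) by (apply Rinv_0_lt_compat; lra).
  split; [apply Rlt_le, Rinv_0_lt_compat; nra|].
  rewrite <- Rinv_1; apply Rinv_lt_contravar; nra.
- intros y _; apply is_lim_seq_Cl2_abel.
- intros eps Heps.
  assert (HN : exists N, forall n, (N <= n)%nat -> / INR (n + 1) < eps * s).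
  { destruct (archimed_cor1 (eps * s)) as [N [HN HN0]]; [nra|].
    exists N; intros n Hn; apply Rle_lt_trans with (2 := HN).
    apply Rinv_le_contravar; [apply lt_0_INR; lia|apply le_INR; lia]. }
  destruct HN as [N HN]; exists N; intros n y Hn Hy.
  specialize (HN n Hn); specialize (HS y Hy).
  assert (Ht : 0 < / INR (n + 1) <= 1).
  { assert (H := INR_succ_ge_1 n).
    split; [apply Rinv_0_lt_compat; lra|rewrite <- Rinv_1; apply Rinv_le_contravar; lra]. }
  revert HN Ht; generalize (/ INR (n + 1)); intros t HN Ht; cbv zeta.
  set (r := / (1 + t ^ 2)).
  assert (Hr : / 2 <= r <= 1 /\ 1 - r <= t).
  { assert (Ht2 : 0 < 1 + t ^ 2) by nra.
    assert (E : r * (1 + t ^ 2) = 1) by (unfold r; field; lra).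
    assert (0 < r) by (unfold r; apply Rinv_0_lt_compat; lra).
    repeat split; nra. }
  rewrite Cl_1_sin2 by (intros E; rewrite E in HS; lra).
  assert (Ec : cos y = 1 - 2 * sin (y / 2) ^ 2).
  { replace y with (2 * (y / 2)) at 1 by field; rewrite cos_2a_sin; ring. }
  assert (HS1 : sin (y / 2) ^ 2 <= 1) by (generalize (SIN_bound (y / 2)); nra).
  rewrite Ec; clear Ec; revert HS HS1; generalize (sin (y / 2) ^ 2); intros S HS HS1.
  rewrite <- Rmult_minus_distr_l, Rabs_mult, Rabs_Ropp, Rabs_pos_eq by lra.
  assert (Hl := ln_lipschitz (2 * s) (4 * S) (1 - 2 * r * (1 - 2 * S) + r ^ 2)).
  apply Rle_lt_trans with (/ 2 * ((4 * (1 - r)) / (2 * s))).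
  + apply Rmult_le_compat_l; [lra|].
    eapply Rle_trans; [apply Hl; nra|].
    apply Rmult_le_compat_r; [apply Rlt_le, Rinv_0_lt_compat; lra|].
    apply Rabs_le; nra.
  + apply Rmult_lt_reg_r with s; [lra|].
    replace (/ 2 * (4 * (1 - r) / (2 * s)) * s) with (1 - r) by (field; lra); lra.
Qed.

(** * The sine product *)

Definition cosint (z : R) (n : nat) : R :=
  RInt (fun t => cos t ^ n * cos (2 * z * t)) 0 (PI / 2).

Lemma continuous_cosint (z : R) (n : nat) (t : R) :
  continuous (fun t => cos t ^ n * cos (2 * z * t)) t.
Proof. apply (ex_derive_continuous (V := R_NormedModule)); auto_derive; auto. Qed.

Lemma is_RInt_cosint (z : R) (n : nat) :
  is_RInt (fun t => cos t ^ n * cos (2 * z * t)) 0 (PI / 2) (cosint z n).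
Proof.
apply (RInt_correct (V := R_CompleteNormedModule)).
apply (ex_RInt_continuous (V := R_CompleteNormedModule)).
intros t _; apply continuous_cosint.
Qed.

(* Integration of the derivative of
   [(n+2) cos^(n+1) t sin t cos (2zt) - 2z cos^(n+2) t sin (2zt)],
   which vanishes at both ends. *)
Lemma cosint_rec (z : R) (n : nat) :
  INR (n + 2) * INR (n + 1) * cosint z n = (INR (n + 2) ^ 2 - 4 * z ^ 2) * cosint z (n + 2).
Proof.
set (F := fun t => INR (n + 2) * (cos t ^ (n + 1) * sin t * cos (2 * z * t))
                   - 2 * z * (cos t ^ (n + 2) * sin (2 * z * t))).
set (f := fun t => (INR (n + 2) ^ 2 - 4 * z ^ 2) * (cos t ^ (n + 2) * cos (2 * z * t))
                   - INR (n + 2) * INR (n + 1) * (cos t ^ n * cos (2 * z * t))).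
assert (H1 : is_RInt f 0 (PI / 2) (F (PI / 2) - F 0)).
{ apply (is_RInt_derive (V := R_CompleteNormedModule) F f).
  - intros t _; unfold F, f; auto_derive; auto.
    replace (Nat.pred (n + 1)) with n by lia.
    replace (Nat.pred (n + 2)) with (n + 1)%nat by lia.
    rewrite !pow_add, !plus_INR; simpl.
    assert (E : sin t * sin t = 1 - cos t * cos t)
      by (generalize (sin2_cos2 t); unfold Rsqr; lra).
    ring [E].
  - intros t _; unfold f.
    apply (ex_derive_continuous (V := R_NormedModule)); auto_derive; auto. }
assert (H2 : is_RInt f 0 (PI / 2)
  ((INR (n + 2) ^ 2 - 4 * z ^ 2) * cosint z (n + 2) - INR (n + 2) * INR (n + 1) * cosint z n)).
{ apply (is_RInt_minus (V := R_NormedModule));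
  apply (is_RInt_scal (V := R_NormedModule)); apply is_RInt_cosint. }
assert (E : F (PI / 2) - F 0 = 0).
{ unfold F; replace (2 * z * 0) with 0 by ring.
  rewrite cos_PI2, !sin_0, !pow_ne_zero by lia; ring. }
apply (is_RInt_unique (V := R_CompleteNormedModule)) in H1.
apply (is_RInt_unique (V := R_CompleteNormedModule)) in H2.
rewrite H1, E in H2; lra.
Qed.

Lemma cosint_0 (z : R) : z <> 0 -> cosint z 0 = sin (PI * z) / (2 * z).
Proof.
intros Hz; apply is_RInt_unique.
apply (is_RInt_ext (fun t => cos (2 * z * t))).
{ intros t _; simpl; now rewrite Rmult_1_l. }
replace (sin (PI * z) / (2 * z))
  with (minus (sin (2 * z * (PI / 2)) / (2 * z)) (sin (2 * z * 0) / (2 * z))).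
- apply (is_RInt_derive (V := R_CompleteNormedModule) (fun t => sin (2 * z * t) / (2 * z))).
  + intros t _; auto_derive; auto; field; auto.
  + intros t _; apply (ex_derive_continuous (V := R_NormedModule)); auto_derive; auto.
- unfold minus, plus, opp; simpl; rewrite Rmult_0_r, sin_0.
  replace (2 * z * (PI / 2)) with (PI * z) by field; field; auto.
Qed.

Lemma cosint_0_0 : cosint 0 0 = PI / 2.
Proof.
apply is_RInt_unique.
apply (is_RInt_ext (fun _ => 1)).
{ intros t _; rewrite Rmult_0_r, Rmult_0_l, cos_0; simpl; ring. }
replace (PI / 2) with (scal (PI / 2 - 0) 1) at 2 by (unfold scal; simpl; unfold mult; simpl; field).
apply (is_RInt_const (V := R_NormedModule)).
Qed.

Lemma mult_cos_le_sin (t : R) : 0 <= t <= PI / 2 -> 0 <= t * cos t <= sin t.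
Proof.
intros Ht; split; [apply Rmult_le_pos; [lra|apply cos_ge_0; lra]|].
destruct (MVT_gen (fun s => sin s - s * cos s) 0 t (fun s => s * sin s)) as [c [Hc E]].
- intros s _; auto_derive; auto; ring.
- intros s _; apply derivable_continuous_pt, ex_derive_Reals_0; auto_derive; auto.
- rewrite sin_0, Rmult_0_l in E.
  rewrite Rmin_left, Rmax_right in Hc by lra.
  assert (0 <= sin c) by (apply sin_ge_0; lra).
  assert (0 <= c * sin c * (t - 0)) by (repeat apply Rmult_le_pos; lra); lra.
Qed.

Lemma one_minus_cos_le (u : R) : 0 <= 1 - cos u <= u ^ 2 / 2.
Proof.
split; [generalize (COS_bound u); lra|].
replace u with (2 * (u / 2)) at 1 by field; rewrite cos_2a_sin.
assert (H : sin (u / 2) ^ 2 <= (u / 2) ^ 2).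
{ rewrite <- !Rsqr_pow2; apply Rsqr_le_abs_1.
  destruct (Req_dec (u / 2) 0) as [->|H]; [rewrite sin_0; lra|].
  destruct (MVT_gen sin 0 (u / 2) cos) as [c [_ E]].
  - intros s _; apply is_derive_sin.
  - intros s _; apply continuity_sin.
  - rewrite sin_0, !Rminus_0_r in E; rewrite E, Rabs_mult.
    rewrite <- (Rmult_1_l (Rabs (u / 2))) at 2.
    apply Rmult_le_compat_r; [apply Rabs_pos|].
    apply Rabs_le; generalize (COS_bound c); lra. }
nra.
Qed.

Lemma cosint_bound (z : R) (n : nat) :
  0 <= cosint 0 (n + 2) - cosint z (n + 2)
    <= 2 * z ^ 2 * (cosint 0 n - cosint 0 (n + 2)).
Proof.
assert (HPI := PI_RGT_0).
assert (H1 := is_RInt_minus (V := R_NormedModule) _ _ _ _ _ _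
  (is_RInt_cosint 0 (n + 2)) (is_RInt_cosint z (n + 2))).
assert (H2 := is_RInt_scal (V := R_NormedModule) _ _ _ (2 * z ^ 2) _
  (is_RInt_minus (V := R_NormedModule) _ _ _ _ _ _
     (is_RInt_cosint 0 n) (is_RInt_cosint 0 (n + 2)))).
assert (Hpt : forall t, 0 < t < PI / 2 ->
  0 <= cos t ^ (n + 2) * cos (2 * 0 * t) - cos t ^ (n + 2) * cos (2 * z * t)
  <= 2 * z ^ 2 * (cos t ^ n * cos (2 * 0 * t) - cos t ^ (n + 2) * cos (2 * 0 * t))).
{ intros t Ht.
  replace (2 * 0 * t) with 0 by ring; rewrite cos_0.
  assert (Hn : 0 <= cos t ^ n) by (apply pow_le, cos_ge_0; lra).
  assert (Hc := one_minus_cos_le (2 * z * t)).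
  assert (Hs := mult_cos_le_sin t ltac:(lra)).
  assert (Hsq : (t * cos t) ^ 2 <= 1 - cos t ^ 2).
  { generalize (sin2_cos2 t); unfold Rsqr; nra. }
  replace (cos t ^ (n + 2)) with (cos t ^ n * cos t ^ 2) by (rewrite pow_add; ring).
  split.
  - replace (_ - _) with (cos t ^ n * (cos t ^ 2 * (1 - cos (2 * z * t)))) by ring.
    apply Rmult_le_pos; auto; apply Rmult_le_pos; [apply pow2_ge_0|lra].
  - replace (_ - _) with (cos t ^ n * (cos t ^ 2 * (1 - cos (2 * z * t)))) by ring.
    replace (2 * z ^ 2 * _) with (cos t ^ n * (2 * z ^ 2 * (1 - cos t ^ 2))) by ring.
    apply Rmult_le_compat_l; auto.
    apply Rle_trans with (2 * z ^ 2 * (t * cos t) ^ 2).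
    + replace (2 * z ^ 2 * (t * cos t) ^ 2) with (cos t ^ 2 * ((2 * z * t) ^ 2 / 2)) by field.
      apply Rmult_le_compat_l; [apply pow2_ge_0|lra].
    + apply Rmult_le_compat_l; [generalize (pow2_ge_0 z); lra|lra]. }
split.
- assert (H0 : is_RInt (fun _ => 0) 0 (PI / 2) (scal (PI / 2 - 0) 0))
    by apply (is_RInt_const (V := R_NormedModule)).
  replace (scal (PI / 2 - 0) 0) with 0 in H0
    by (unfold scal; simpl; unfold mult; simpl; ring).
  apply (is_RInt_le _ _ 0 (PI / 2)) with (2 := H0) (3 := H1); [lra|apply Hpt].
- apply (is_RInt_le _ _ 0 (PI / 2)) with (2 := H1) (3 := H2); [lra|apply Hpt].
Qed.

Lemma cosint_0_pos (m : nat) : 0 < cosint 0 (2 * m).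
Proof.
induction m as [|m IH].
- simpl Nat.mul; rewrite cosint_0_0; generalize PI_RGT_0; lra.
- assert (H := cosint_rec 0 (2 * m)).
  replace (2 * S m)%nat with (2 * m + 2)%nat by lia.
  assert (H1 : 0 < INR (2 * m + 1)) by (apply lt_0_INR; lia).
  assert (H2 : 0 < INR (2 * m + 2)) by (apply lt_0_INR; lia).
  assert (0 < INR (2 * m + 2) * INR (2 * m + 1) * cosint 0 (2 * m))
    by (repeat apply Rmult_lt_0_compat; auto).
  assert (0 < INR (2 * m + 2) ^ 2) by now apply pow_lt.
  nra.
Qed.

Lemma cosint_ratio_step (z : R) (m : nat) :
  cosint z (2 * m) / cosint 0 (2 * m)
  = (1 - z ^ 2 / INR (m + 1) ^ 2) * (cosint z (2 * S m) / cosint 0 (2 * S m)).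
Proof.
assert (Hz := cosint_rec z (2 * m)); assert (H0 := cosint_rec 0 (2 * m)).
assert (P := cosint_0_pos m); assert (P' := cosint_0_pos (S m)).
replace (2 * S m)%nat with (2 * m + 2)%nat in * by lia.
assert (H1 : 0 < INR (2 * m + 1)) by (apply lt_0_INR; lia).
assert (Hm : 1 <= INR (m + 1)) by apply INR_succ_ge_1.
replace (INR (2 * m + 2)) with (2 * INR (m + 1)) in *
  by (rewrite !plus_INR, mult_INR; simpl; ring).
set (u := INR (m + 1)) in *; set (v := INR (2 * m + 1)) in *.
set (A := cosint z (2 * m)) in *; set (B := cosint 0 (2 * m)) in *.
set (A' := cosint z (2 * m + 2)) in *; set (B' := cosint 0 (2 * m + 2)) in *.
assert (EA : A = (2 * (u ^ 2 - z ^ 2) / (u * v)) * A').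
{ apply Rmult_eq_reg_l with (2 * u * v); [|apply Rgt_not_eq; nra].
  rewrite Hz; field; lra. }
assert (EB : B = (2 * u / v) * B').
{ apply Rmult_eq_reg_l with (2 * u * v); [|apply Rgt_not_eq; nra].
  rewrite H0; field; lra. }
rewrite EA, EB; field; repeat split; lra.
Qed.

Lemma is_lim_seq_cosint_ratio (z : R) :
  is_lim_seq (fun m => cosint z (2 * m) / cosint 0 (2 * m)) 1.
Proof.
apply is_lim_seq_incr_1.
apply is_lim_seq_le_le with (fun m => 1 - 2 * z ^ 2 * / INR (m + 1)) (fun _ => 1).
- intros m.
  assert (Hb := cosint_bound z (2 * m)); assert (H0 := cosint_rec 0 (2 * m)).
  assert (P' := cosint_0_pos (S m)).
  replace (2 * S m)%nat with (2 * m + 2)%nat in * by lia.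
  assert (Hm : 1 <= INR (m + 1)) by apply INR_succ_ge_1.
  assert (Hv : INR (m + 1) <= INR (2 * m + 1)) by (apply le_INR; lia).
  replace (INR (2 * m + 2)) with (INR (2 * m + 1) + 1) in *
    by (rewrite !plus_INR, mult_INR; simpl; ring).
  revert Hv Hb H0 Hm P'; generalize (INR (2 * m + 1)) (INR (m + 1)).
  generalize (cosint z (2 * m + 2)) (cosint 0 (2 * m + 2)) (cosint 0 (2 * m)).
  intros A' B' B v u Hv Hb H0 Hm P'.
  assert (EB : B - B' = B' / v).
  { apply Rmult_eq_reg_l with ((v + 1) * v); [|apply Rgt_not_eq; nra].
    rewrite Rmult_minus_distr_l, H0; field; lra. }
  rewrite EB in Hb; split.
  + apply Rmult_le_reg_r with B'; auto.
    replace (A' / B' * B') with A' by (field; lra).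
    enough (2 * z ^ 2 * (B' / v) <= 2 * z ^ 2 * / u * B') by lra.
    unfold Rdiv; rewrite (Rmult_comm B'), <- Rmult_assoc.
    apply Rmult_le_compat_r; [lra|apply Rmult_le_compat_l].
    * generalize (pow2_ge_0 z); lra.
    * apply Rinv_le_contravar; lra.
  + apply Rmult_le_reg_r with B'; auto.
    replace (A' / B' * B') with A' by (field; lra); lra.
- replace (Finite 1) with (Finite (1 - 2 * z ^ 2 * 0)) by (f_equal; ring).
  apply is_lim_seq_minus'; [apply is_lim_seq_const|].
  apply is_lim_seq_mult'; [apply is_lim_seq_const|].
  apply is_lim_seq_inv_INR.
- apply is_lim_seq_const.
Qed.

Lemma sin_PI_mult_pos (z : R) : 0 < z < 1 -> 0 < sin (PI * z).
Proof. intros Hz; generalize PI_RGT_0; intros; apply sin_gt_0; nra. Qed.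

Lemma is_series_ln_sine_product (z : R) :
  0 < z < 1 ->
  is_series (fun m => - ln (1 - z ^ 2 / INR (m + 1) ^ 2)) (ln (PI * z / sin (PI * z))).
Proof.
intros Hz.
assert (HPI := PI_RGT_0); assert (Hsin := sin_PI_mult_pos z Hz).
assert (Hf : forall m, 0 < 1 - z ^ 2 / INR (m + 1) ^ 2).
{ intros m; assert (Hm := INR_succ_ge_1 m).
  enough (z ^ 2 / INR (m + 1) ^ 2 < 1) by lra.
  apply Rmult_lt_reg_r with (INR (m + 1) ^ 2); [nra|].
  unfold Rdiv; rewrite Rmult_assoc, Rinv_l by (apply Rgt_not_eq; nra); nra. }
set (q := fun m => cosint z (2 * m) / cosint 0 (2 * m)).
assert (q0 : q 0%nat = sin (PI * z) / (PI * z)).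
{ unfold q; simpl Nat.mul; rewrite cosint_0_0, cosint_0 by lra; field; lra. }
assert (Hq : forall m, 0 < q m).
{ induction m as [|m IH].
  - rewrite q0; apply Rdiv_lt_0_compat; nra.
  - assert (E := cosint_ratio_step z m); fold (q m) (q (S m)) in E.
    assert (H := Hf m); nra. }
assert (Hs : forall m, sum_n (fun m => - ln (1 - z ^ 2 / INR (m + 1) ^ 2)) m
                       = ln (PI * z / sin (PI * z)) + ln (q (S m)) :> R).
{ assert (Hstep : forall m, ln (q m) = ln (1 - z ^ 2 / INR (m + 1) ^ 2) + ln (q (S m))).
  { intros m; rewrite <- (ln_mult _ _ (Hf m) (Hq (S m))).
    apply (f_equal ln); exact (cosint_ratio_step z m). }
  induction m as [|m IH].
  - rewrite sum_n_zero.
    replace (ln (PI * z / sin (PI * z))) with (- ln (q 0%nat)).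
    + rewrite (Hstep 0%nat); ring.
    + rewrite q0, <- ln_Rinv by (apply Rdiv_lt_0_compat; nra).
      f_equal; field; split; lra.
  - rewrite sum_n_succ, IH, (Hstep (S m)); ring. }
assert (Hlim : is_lim_seq q 1) by exact (is_lim_seq_cosint_ratio z).
clearbody q.
apply is_series_lim, (is_lim_seq_ext _ _ _ (fun m => eq_sym (Hs m))).
rewrite <- (Rplus_0_r (ln (PI * z / sin (PI * z)))) at 1.
apply is_lim_seq_plus'; [apply is_lim_seq_const|].
rewrite <- ln_1.
apply (is_lim_seq_continuous ln (fun m => q (S m))).
- apply continuity_pt_is_derive with (/ 1); apply is_derive_ln; lra.
- apply -> (is_lim_seq_incr_1 q); exact Hlim.
Qed.

Lemma sum_n_le_series (u : nat -> R) (l : R) (n : nat) :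
  (forall k, 0 <= u k) -> is_series u l -> sum_n u n <= l.
Proof.
intros Hu Hl; apply (is_lim_seq_incr_compare (sum_n u) l Hl).
intros i; rewrite sum_n_succ; generalize (Hu (S i)); lra.
Qed.

Lemma is_series_swap_nonneg (a : nat -> nat -> R) (b c : nat -> R) (l : R) :
  (forall m k, 0 <= a m k) ->
  (forall m, is_series (a m) (b m)) ->
  (forall k, is_series (fun m => a m k) (c k)) ->
  is_series b l -> is_series c l.
Proof.
assert (Hsum : forall (a : nat -> nat -> R) (c : nat -> R) K,
  (forall k, is_series (fun m => a m k) (c k)) ->
  is_series (fun m => sum_n (a m) K) (sum_n c K)).
{ intros a' c' K Hc; induction K as [|K IH].
  - rewrite sum_n_zero; apply (is_series_ext_R _ _ _ (Hc 0%nat)); intros m; now rewrite sum_n_zero.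
  - rewrite sum_n_succ.
    apply is_series_ext_R with (fun m => sum_n (a' m) K + a' m (S K)).
    + apply (is_series_plus _ _ _ _ IH (Hc (S K))).
    + intros m; now rewrite sum_n_succ. }
assert (Hle : forall (u v : nat -> R) lu lv, (forall n, u n <= v n) ->
  is_series u lu -> is_series v lv -> lu <= lv).
{ intros u v lu lv H Hu Hv.
  apply (is_lim_seq_le (sum_n u) (sum_n v) lu lv); auto.
  intros n; induction n; rewrite ?sum_n_zero, ?sum_n_succ; auto using Rplus_le_compat. }
intros Ha Hb Hc Hl.
assert (Hc0 : forall k, 0 <= c k).
{ intros k; apply Rle_trans with (sum_n (fun m => a m k) 0); [rewrite sum_n_zero; apply Ha|].
  apply sum_n_le_series; auto. }
assert (Hbound : forall K, sum_n c K <= l).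
{ intros K; apply (Hle (fun m => sum_n (a m) K) b); auto.
  intros m; apply sum_n_le_series; auto. }
destruct (ex_finite_lim_seq_incr (sum_n c) l) as [l' Hl']; auto.
{ intros n; rewrite sum_n_succ; generalize (Hc0 (S n)); lra. }
assert (l' <= l).
{ apply (is_lim_seq_le (sum_n c) (fun _ => l) l' l); auto; apply is_lim_seq_const. }
assert (l <= l').
{ apply (is_lim_seq_le (sum_n b) (fun _ => l') l l'); [|exact Hl|apply is_lim_seq_const].
  intros M; apply (Hle (fun k => sum_n (fun m => a m k) M) c).
  - intros k; apply sum_n_le_series; auto.
  - apply (Hsum (fun k m => a m k) b M Hb).
  - exact Hl'. }
replace l with l' by lra; exact Hl'.
Qed.

Lemma is_series_zeta (z : R) :
  0 < z < 1 ->
  is_series (fun k => zeta (2 * (k + 1)) * z ^ (2 * (k + 1)) / INR (k + 1))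
    (ln (PI * z / sin (PI * z))).
Proof.
intros Hz.
apply is_series_swap_nonneg with
  (a := fun m k => (z ^ 2 / INR (m + 1) ^ 2) ^ S k / INR (S k))
  (b := fun m => - ln (1 - z ^ 2 / INR (m + 1) ^ 2)).
- intros m k; assert (Hm := INR_succ_ge_1 m).
  apply Rmult_le_pos; [apply pow_le, Rmult_le_pos; [nra|]|];
  apply Rlt_le, Rinv_0_lt_compat; [nra|apply lt_0_INR; lia].
- intros m; assert (Hm := INR_succ_ge_1 m); apply is_series_ln.
  assert (0 < z ^ 2 / INR (m + 1) ^ 2) by (apply Rdiv_lt_0_compat; nra).
  rewrite Rabs_pos_eq by lra.
  apply Rmult_lt_reg_r with (INR (m + 1) ^ 2); [nra|].
  unfold Rdiv; rewrite Rmult_assoc, Rinv_l by (apply Rgt_not_eq; nra); nra.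
- intros k.
  apply is_series_ext_R with
    (fun m => z ^ (2 * (k + 1)) / INR (k + 1) * / INR (m + 1) ^ (2 * (k + 1))).
  + replace (zeta (2 * (k + 1)) * z ^ (2 * (k + 1)) / INR (k + 1))
      with (z ^ (2 * (k + 1)) / INR (k + 1) * zeta (2 * (k + 1))) by (unfold Rdiv; ring).
    apply is_series_scal_R.
    apply Series_correct, ex_series_inv_pow; lia.
  + intros m; assert (Hm := INR_succ_ge_1 m).
    unfold Rdiv; rewrite Rpow_mult_distr, pow_inv, <- !pow_mult.
    replace (S k) with (k + 1)%nat by lia; ring.
- now apply is_series_ln_sine_product.
Qed.

(** * Integration of the logarithmic series *)

Definition prim_term (q : nat) (x : R) (i : nat) : R :=
  (-1) ^ Nat.div2 i * (Cl (S (S i)) x * (x ^ (q - i) / INR (fact (q - i)))).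

(* Repeated integration by parts of [Cl 1 x * x ^ q / q!]. *)
Definition Cl_prim (q : nat) (x : R) : R := sum_n (prim_term q x) q.

Lemma div2_sign (i : nat) : (-1) ^ Nat.div2 (S i) * (-1) ^ S i = - (-1) ^ Nat.div2 i.
Proof.
destruct (Nat.Even_or_Odd i) as [[j ->]|[j ->]].
- rewrite Nat.div2_succ_double, Nat.div2_double, pow_1_odd; ring.
- replace (S (2 * j + 1)) with (2 * S j)%nat by lia.
  rewrite Nat.add_1_r, Nat.div2_succ_double, Nat.div2_double, pow_1_even; simpl; ring.
Qed.

Definition dpow_fact (k : nat) (x : R) : R :=
  match k with O => 0 | S k' => x ^ k' / INR (fact k') end.

Lemma is_derive_pow_succ (n : nat) (x : R) :
  is_derive (fun y => y ^ S n) x (INR (S n) * x ^ n).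
Proof.
replace (INR (S n) * x ^ n) with (INR (S n) * 1 * x ^ Nat.pred (S n)) by (simpl Nat.pred; ring).
apply (is_derive_pow (fun y => y)), (is_derive_id (K := R_AbsRing)).
Qed.

Lemma is_derive_pow_fact (k : nat) (x : R) :
  is_derive (fun y => y ^ k / INR (fact k)) x (dpow_fact k x).
Proof.
assert (H := INR_fact_neq_0 k).
destruct k as [|k]; unfold dpow_fact.
- apply is_derive_ext_R with (fun _ => 1 / INR (fact 0)); [reflexivity|].
  apply (is_derive_const (V := R_NormedModule)).
- assert (H' := INR_fact_neq_0 k).
  replace (x ^ k / INR (fact k)) with (/ INR (fact (S k)) * (INR (S k) * x ^ k)).
  + apply is_derive_ext_R with (fun y => / INR (fact (S k)) * y ^ S k).
    { intros y; apply Rmult_comm. }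
    apply (is_derive_scal (fun y => y ^ S k)), is_derive_pow_succ.
  + rewrite fact_simpl, mult_INR; field; split; auto; apply not_0_INR; lia.
Qed.

Lemma is_derive_prim_term (q i : nat) (x l : R) :
  is_derive (Cl (S (S i))) x l ->
  is_derive (fun y => prim_term q y i) x
    ((-1) ^ Nat.div2 i * (l * (x ^ (q - i) / INR (fact (q - i)))
                          + Cl (S (S i)) x * dpow_fact (q - i) x)).
Proof.
intros Hl; apply (is_derive_scal (fun y => Cl (S (S i)) y * (y ^ (q - i) / INR (fact (q - i))))).
apply (is_derive_mult (Cl (S (S i))) (fun y => y ^ (q - i) / INR (fact (q - i)))); auto.
- apply is_derive_pow_fact.
- intros; apply Rmult_comm.
Qed.

Lemma is_derive_Cl_prim (q : nat) (x : R) :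
  sin (x / 2) <> 0 -> is_derive (Cl_prim q) x (Cl 1 x * (x ^ q / INR (fact q))).
Proof.
intros Hx.
assert (H : forall m, (m <= q)%nat ->
  is_derive (fun y => sum_n (prim_term q y) m) x
    (Cl 1 x * (x ^ q / INR (fact q))
     + (-1) ^ Nat.div2 m * (Cl (S (S m)) x * dpow_fact (q - m) x))).
{ induction m as [|m IH]; intros Hm.
  - apply is_derive_ext_R with (fun y => prim_term q y 0).
    { intros y; symmetry; apply sum_n_zero. }
    replace (_ + _) with ((-1) ^ Nat.div2 0 * (Cl 1 x * (x ^ (q - 0) / INR (fact (q - 0)))
                          + Cl 2 x * dpow_fact (q - 0) x))
      by (rewrite Nat.sub_0_r; simpl Nat.div2; ring).
    now apply is_derive_prim_term, is_derive_Cl_2.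
  - apply is_derive_ext_R with (fun y => sum_n (prim_term q y) m + prim_term q y (S m)).
    { intros y; symmetry; apply sum_n_succ. }
    assert (Hs := div2_sign m).
    replace (_ + _) with
      ((Cl 1 x * (x ^ q / INR (fact q))
        + (-1) ^ Nat.div2 m * (Cl (S (S m)) x * dpow_fact (q - m) x))
       + (-1) ^ Nat.div2 (S m) *
         ((-1) ^ S m * Cl (S (S m)) x * (x ^ (q - S m) / INR (fact (q - S m)))
          + Cl (S (S (S m))) x * dpow_fact (q - S m) x)).
    + apply (is_derive_plus (V := R_NormedModule)); [apply IH; lia|].
      apply is_derive_prim_term, is_derive_Cl.
    + replace (q - m)%nat with (S (q - S m)) by lia.
      unfold dpow_fact at 1; ring [Hs]. }
specialize (H q (le_n q)); rewrite Nat.sub_diag in H; simpl dpow_fact in H.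
rewrite !Rmult_0_r, Rplus_0_r in H; exact H.
Qed.

Lemma continuity_pt_Cl_prim (q : nat) (x : R) : continuity_pt (Cl_prim q) x.
Proof.
apply (continuity_pt_sum_n (fun i y => prim_term q y i)); intros i.
apply continuity_pt_scal with (f := fun y => Cl (S (S i)) y * (y ^ (q - i) / INR (fact (q - i)))).
apply (continuity_pt_mult (Cl (S (S i))) (fun y => y ^ (q - i) / INR (fact (q - i)))).
- apply continuity_pt_Cl.
- eapply continuity_pt_is_derive, is_derive_pow_fact.
Qed.

Lemma sum_n_eq_R (a b : nat -> R) (n : nat) :
  (forall i, (i <= n)%nat -> a i = b i) -> sum_n a n = sum_n b n.
Proof. exact (sum_n_ext_loc a b n). Qed.

Lemma Cl_prim_0 (q : nat) : Cl_prim q 0 = (-1) ^ Nat.div2 q * Cl (S (S q)) 0.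
Proof.
assert (Hlast : prim_term q 0 q = (-1) ^ Nat.div2 q * Cl (S (S q)) 0).
{ unfold prim_term; rewrite Nat.sub_diag; simpl fact; simpl pow; simpl INR; field. }
unfold Cl_prim; destruct q as [|q].
- rewrite sum_n_zero; exact Hlast.
- rewrite sum_n_succ, Hlast.
  rewrite (sum_n_eq_R _ (fun _ => 0)).
  + rewrite sum_n_const; ring.
  + intros i Hi; unfold prim_term; rewrite pow_ne_zero by lia; unfold Rdiv; ring.
Qed.

Lemma trig_opp (i : nat) (x : R) : trig i (- x) = (-1) ^ S i * trig i x.
Proof.
unfold trig; destruct (Nat.Even_or_Odd i) as [[j ->]|[j ->]].
- rewrite Nat.even_even, pow_1_odd, sin_neg; ring.
- rewrite Nat.even_odd; replace (S (2 * j + 1)) with (2 * S j)%nat by lia.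
  rewrite pow_1_even, cos_neg; ring.
Qed.

Lemma Cl_opp (i : nat) (x : R) : Cl (S (S i)) (- x) = (-1) ^ S i * Cl (S (S i)) x.
Proof.
rewrite !Cl_trig, <- Series_scal_l; apply Series_ext; intros k.
rewrite Ropp_mult_distr_r_reverse, trig_opp; unfold Rdiv; ring.
Qed.

Lemma Cl_prim_opp (q : nat) (x : R) : Cl_prim q (- x) = (-1) ^ S q * Cl_prim q x.
Proof.
unfold Cl_prim; rewrite <- (sum_n_mult_l (K := R_Ring)).
apply sum_n_eq_R; intros i Hi; unfold prim_term, mult; simpl mult.
rewrite Cl_opp; replace (- x) with (-1 * x) by ring; rewrite Rpow_mult_distr.
replace (S q) with (S i + (q - i))%nat by lia; rewrite pow_add.
unfold Rdiv; simpl; ring.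
Qed.

Definition Psi (q : nat) (x : R) : R :=
  x ^ S q / INR (S q) * ln x - x ^ S q / INR (S q) ^ 2
  + INR (fact q) * (Cl_prim q x - Cl_prim q 0).

Lemma sin_half_pos (x : R) : 0 < x < 2 * PI -> 0 < sin (x / 2).
Proof. intros Hx; apply sin_gt_0; lra. Qed.

Lemma is_derive_Psi (q : nat) (x : R) :
  0 < x < 2 * PI -> is_derive (Psi q) x (x ^ q * (ln x + Cl 1 x)).
Proof.
intros Hx.
assert (HS : INR (S q) <> 0) by (apply not_0_INR; lia).
assert (Hf := INR_fact_neq_0 q).
replace (x ^ q * (ln x + Cl 1 x)) with
  (x ^ q * ln x + INR (fact q) * (Cl 1 x * (x ^ q / INR (fact q)) - 0)) by (field; auto).
apply (is_derive_plus (V := R_NormedModule)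
  (fun x => x ^ S q / INR (S q) * ln x - x ^ S q / INR (S q) ^ 2)).
- apply is_derive_ext_R with (fun x => x ^ S q * (ln x / INR (S q) - / INR (S q) ^ 2)).
  { intros y; unfold Rdiv; ring. }
  replace (x ^ q * ln x) with
    (INR (S q) * x ^ q * (ln x / INR (S q) - / INR (S q) ^ 2) + x ^ S q * (/ x / INR (S q)))
    by (revert HS; generalize (INR (S q)); intros c Hc; rewrite <- (tech_pow_Rmult x q); field; split; [lra|exact Hc]).
  apply (is_derive_mult (fun x => x ^ S q) (fun x => ln x / INR (S q) - / INR (S q) ^ 2)).
  + apply is_derive_pow_succ.
  + generalize (INR (S q)); intros c; auto_derive; [lra|unfold Rdiv; ring].
  + intros; apply Rmult_comm.
- apply (is_derive_scal (fun x => Cl_prim q x - Cl_prim q 0)).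
  apply (is_derive_minus (V := R_NormedModule)).
  + apply is_derive_Cl_prim, Rgt_not_eq, sin_half_pos; auto.
  + apply (is_derive_const (V := R_NormedModule)).
Qed.

Lemma is_lim_seq_Psi_0 (q : nat) (a : R) :
  0 < a -> is_lim_seq (fun n => Psi q (a * / INR (n + 1))) 0.
Proof.
intros Ha.
assert (Hx : is_lim_seq (fun n => a * / INR (n + 1)) 0).
{ replace (Finite 0) with (Finite (a * 0)) by (f_equal; ring).
  apply is_lim_seq_mult'; [apply is_lim_seq_const|apply is_lim_seq_inv_INR]. }
assert (Hpow : forall k, is_lim_seq (fun n => (a * / INR (n + 1)) ^ k) (0 ^ k)).
{ intros k; apply (is_lim_seq_continuous (fun y => y ^ k) (fun n => a * / INR (n + 1))); auto.
  apply derivable_continuous_pt, derivable_pt_pow. }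
assert (Hln : is_lim_seq (fun n => a * / INR (n + 1) * ln (a * / INR (n + 1))) 0).
{ apply is_lim_seq_ext with
    (fun n => (a * / INR (n + 1)) * ln a - a * (ln (INR (n + 1)) / INR (n + 1))).
  - intros n; assert (H := INR_succ_ge_1 n).
    rewrite ln_mult, ln_Rinv by (try apply Rinv_0_lt_compat; lra); unfold Rdiv; ring.
  - replace (Finite 0) with (Finite (0 * ln a - a * 0)) by (f_equal; ring).
    apply is_lim_seq_minus'; apply is_lim_seq_mult'; auto; try apply is_lim_seq_const.
    apply (is_lim_comp_seq (fun y => ln y / y) (fun n => INR (n + 1)) p_infty 0).
    + apply is_lim_div_ln_p.
    + exists 0%nat; intros; discriminate.
    + apply (is_lim_seq_incr_n INR 1), is_lim_seq_INR. }
unfold Psi.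
replace (Finite 0) with (Finite (0 ^ q * 0 * / INR (S q) - 0 ^ S q * / INR (S q) ^ 2
  + INR (fact q) * (Cl_prim q 0 - Cl_prim q 0))) by (f_equal; simpl; ring).
apply is_lim_seq_plus'; [apply is_lim_seq_minus'|].
- apply is_lim_seq_ext with
    (fun n => (a * / INR (n + 1)) ^ q * (a * / INR (n + 1) * ln (a * / INR (n + 1))) * / INR (S q)).
  + intros n; rewrite <- (tech_pow_Rmult _ q); unfold Rdiv; ring.
  + apply is_lim_seq_mult'; [|apply is_lim_seq_const].
    apply is_lim_seq_mult'; auto.
- apply is_lim_seq_mult'; [apply Hpow|apply is_lim_seq_const].
- apply is_lim_seq_mult'; [apply is_lim_seq_const|].
  apply is_lim_seq_minus'; [|apply is_lim_seq_const].
  apply (is_lim_seq_continuous (Cl_prim q) (fun n => a * / INR (n + 1))); auto.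
  apply continuity_pt_Cl_prim.
Qed.

Lemma ln_plus_Cl_1 (z : R) :
  0 < z < 1 -> ln (2 * PI * z) + Cl 1 (2 * PI * z) = ln (PI * z / sin (PI * z)).
Proof.
intros Hz; assert (HPI := PI_RGT_0); assert (Hs := sin_PI_mult_pos z Hz).
unfold Cl; replace (2 * PI * z / 2) with (PI * z) by field.
rewrite Rabs_pos_eq by lra.
rewrite ln_div, (ln_mult 2 (sin (PI * z))) by nra.
rewrite Rmult_assoc, (ln_mult 2 (PI * z)) by nra; ring.
Qed.

Lemma remainder_le (u v : nat -> R) (lu lv : R) (n : nat) :
  (forall k, 0 <= u k <= v k) -> is_series u lu -> is_series v lv ->
  0 <= lu - sum_n u n <= lv - sum_n v n.
Proof.
intros H Hu Hv; split.
- assert (sum_n u n <= lu) by (apply sum_n_le_series; auto; intros k; apply H); lra.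
- enough (sum_n v n - sum_n u n <= lv - lu) by lra.
  apply (is_lim_seq_incr_compare (fun n => sum_n v n - sum_n u n) (lv - lu)).
  + now apply is_lim_seq_minus'.
  + intros k; rewrite !sum_n_succ; generalize (H (S k)); lra.
Qed.

Lemma zeta_pos (s : nat) : (2 <= s)%nat -> 0 <= zeta s.
Proof.
intros Hs; apply Rle_trans with (sum_n (fun m => / INR (m + 1) ^ s) 0).
- rewrite sum_n_zero; simpl INR; rewrite pow1; lra.
- apply sum_n_le_series.
  + intros k; apply Rlt_le, Rinv_0_lt_compat, pow_lt; generalize (INR_succ_ge_1 k); lra.
  + now apply Series_correct, ex_series_inv_pow.
Qed.

Definition zeta_term (q : nat) (z : R) (k : nat) : R :=
  zeta (2 * (k + 1)) * z ^ (2 * (k + 1)) / (INR (k + 1) * INR (2 * (k + 1) + S q)).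

Lemma is_derive_zeta_sum (q K : nat) (t : R) :
  is_derive (fun t => t ^ S q * sum_n (zeta_term q t) K) t
    (t ^ q * sum_n (fun k => zeta (2 * (k + 1)) * t ^ (2 * (k + 1)) / INR (k + 1)) K).
Proof.
assert (Hk : forall k, is_derive (fun t => t ^ S q * zeta_term q t k) t
  (t ^ q * (zeta (2 * (k + 1)) * t ^ (2 * (k + 1)) / INR (k + 1)))).
{ intros k; unfold zeta_term.
  assert (H1 := INR_succ_ge_1 k).
  assert (H2 : INR (2 * (k + 1) + S q) <> 0) by (apply not_0_INR; lia).
  apply is_derive_ext_R with (fun t => zeta (2 * (k + 1)) / (INR (k + 1) * INR (2 * (k + 1) + S q))
                                     * t ^ (2 * (k + 1) + S q)).
  { intros y; rewrite pow_add; field; split; auto; lra. }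
  replace (t ^ q * _) with (zeta (2 * (k + 1)) / (INR (k + 1) * INR (2 * (k + 1) + S q))
    * (INR (2 * (k + 1) + S q) * t ^ (2 * (k + 1) + q)))
    by (rewrite pow_add; field; split; auto; lra).
  apply (is_derive_scal (fun t => t ^ (2 * (k + 1) + S q))).
  replace (2 * (k + 1) + S q)%nat with (S (2 * (k + 1) + q)) by lia.
  apply is_derive_pow_succ. }
induction K as [|K IH].
- rewrite sum_n_zero; apply is_derive_ext_R with (2 := Hk 0%nat); intros y; now rewrite sum_n_zero.
- rewrite sum_n_succ, Rmult_plus_distr_l.
  apply is_derive_ext_R with (fun t => t ^ S q * sum_n (zeta_term q t) K + t ^ S q * zeta_term q t (S K)).
  { intros y; rewrite sum_n_succ; ring. }
  apply (is_derive_plus (V := R_NormedModule)); auto.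
Qed.

Lemma Psi_zeta_bound (q K : nat) (z : R) :
  0 < z < 1 ->
  0 <= Psi q (2 * PI * z) / (2 * PI) ^ S q - z ^ S q * sum_n (zeta_term q z) K
    <= ln (PI * z / sin (PI * z))
       - sum_n (fun k => zeta (2 * (k + 1)) * z ^ (2 * (k + 1)) / INR (k + 1)) K.
Proof.
intros Hz; assert (HPI := PI_RGT_0).
assert (Hpp : forall k, 0 < (2 * PI) ^ k) by (intros k; apply pow_lt; lra).
set (f := fun t => ln (PI * t / sin (PI * t))).
set (s := fun t => sum_n (fun k => zeta (2 * (k + 1)) * t ^ (2 * (k + 1)) / INR (k + 1)) K).
set (W := fun t => Psi q (2 * PI * t) / (2 * PI) ^ S q - t ^ S q * sum_n (zeta_term q t) K).
assert (HW : forall t, 0 < t < 1 -> is_derive W t (t ^ q * (f t - s t))).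
{ intros t Ht; unfold W, f, s; rewrite Rmult_minus_distr_l.
  apply (is_derive_minus (V := R_NormedModule)); [|apply is_derive_zeta_sum].
  rewrite <- ln_plus_Cl_1 by auto.
  replace (t ^ q * _) with (/ (2 * PI) ^ S q * (2 * PI * ((2 * PI * t) ^ q
    * (ln (2 * PI * t) + Cl 1 (2 * PI * t))))).
  2: { rewrite (Rpow_mult_distr (2 * PI) t q), <- (tech_pow_Rmult (2 * PI) q).
       generalize (Rgt_not_eq _ _ (Hpp q)); intros; field; split; [assumption|lra]. }
  apply is_derive_ext_R with (fun t => / (2 * PI) ^ S q * Psi q (2 * PI * t)).
  { intros y; apply Rmult_comm. }
  apply (is_derive_scal (fun t => Psi q (2 * PI * t))).
  apply (is_derive_comp (Psi q) (fun t => 2 * PI * t)).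
  - apply is_derive_Psi; nra.
  - auto_derive; auto; ring. }
assert (Hrem : forall t, 0 < t <= z -> 0 <= t ^ q * (f t - s t) <= f z - s z).
{ intros t Ht.
  assert (Hr : 0 <= f t - s t <= f z - s z).
  { apply (remainder_le (fun k => zeta (2 * (k + 1)) * t ^ (2 * (k + 1)) / INR (k + 1))
      (fun k => zeta (2 * (k + 1)) * z ^ (2 * (k + 1)) / INR (k + 1))).
    - intros k; assert (Hzk := zeta_pos (2 * (k + 1)) ltac:(lia)).
      assert (Hk : 0 < / INR (k + 1)) by (apply Rinv_0_lt_compat; generalize (INR_succ_ge_1 k); lra).
      assert (0 <= t ^ (2 * (k + 1)) <= z ^ (2 * (k + 1)))
        by (split; [apply pow_le; lra|apply pow_incr; lra]).
      unfold Rdiv; split.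
      + repeat apply Rmult_le_pos; lra.
      + apply Rmult_le_compat_r; [lra|]; apply Rmult_le_compat_l; lra.
    - apply is_series_zeta; lra.
    - apply is_series_zeta; lra. }
  assert (Hq : 0 <= t ^ q <= 1).
  { split; [apply pow_le; lra|rewrite <- (pow1 q); apply pow_incr; lra]. }
  split; [apply Rmult_le_pos; lra|nra]. }
assert (Hinc : forall e, 0 < e < z -> 0 <= W z - W e <= f z - s z).
{ intros e He.
  destruct (MVT_gen W e z (fun t => t ^ q * (f t - s t))) as [c [Hc E]].
  - rewrite Rmin_left, Rmax_right by lra; intros t Ht; apply HW; lra.
  - rewrite Rmin_left, Rmax_right by lra; intros t Ht.
    eapply continuity_pt_is_derive, HW; lra.
  - rewrite Rmin_left, Rmax_right in Hc by lra.
    rewrite E; generalize (Hrem c ltac:(lra)); intros; split; [apply Rmult_le_pos; lra|nra]. }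
assert (Hlim : is_lim_seq (fun n => W z - W (z * / INR (n + 2))) (W z)).
{ replace (Finite (W z)) with (Finite (W z - 0)) by (f_equal; ring).
  apply is_lim_seq_minus'; [apply is_lim_seq_const|].
  assert (Hx : is_lim_seq (fun n => z * / INR (n + 1)) 0).
  { replace (Finite 0) with (Finite (z * 0)) by (f_equal; ring).
    apply is_lim_seq_mult'; [apply is_lim_seq_const|apply is_lim_seq_inv_INR]. }
  apply is_lim_seq_ext with (fun n => W (z * / INR (S n + 1))).
  { intros n; replace (S n + 1)%nat with (n + 2)%nat by lia; reflexivity. }
  apply -> (is_lim_seq_incr_1 (fun n => W (z * / INR (n + 1)))); unfold W.
  replace (Finite 0) with (Finite (0 * / (2 * PI) ^ S q - 0 ^ S q * sum_n (zeta_term q 0) K))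
    by (f_equal; rewrite pow_ne_zero by lia; ring).
  apply is_lim_seq_minus'.
  - apply is_lim_seq_mult'; [|apply is_lim_seq_const].
    apply is_lim_seq_ext with (fun n => Psi q (2 * PI * z * / INR (n + 1))).
    + intros n; f_equal; ring.
    + apply is_lim_seq_Psi_0; nra.
  - apply (is_lim_seq_continuous (fun t => t ^ S q * sum_n (zeta_term q t) K)); auto.
    eapply continuity_pt_is_derive, is_derive_zeta_sum. }
assert (Hn : forall n, 0 < z * / INR (n + 2) < z).
{ intros n; assert (H : 1 < INR (n + 2)).
  { replace (n + 2)%nat with (S (n + 1)) by lia; rewrite S_INR; generalize (INR_succ_ge_1 n); lra. }
  assert (0 < / INR (n + 2) < 1).
  { split; [apply Rinv_0_lt_compat; lra|rewrite <- Rinv_1; apply Rinv_lt_contravar; lra]. }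
  nra. }
split.
- apply (is_lim_seq_le (fun _ => 0) (fun n => W z - W (z * / INR (n + 2))) 0 (W z)); auto.
  + intros n; apply Hinc, Hn.
  + apply is_lim_seq_const.
- apply (is_lim_seq_le (fun n => W z - W (z * / INR (n + 2))) (fun _ => f z - s z) (W z) (f z - s z)); auto.
  + intros n; apply Hinc, Hn.
  + apply is_lim_seq_const.
Qed.

Definition zeta_value (q : nat) (x : R) : R :=
  ln (Rabs x) / INR (S q) - / INR (S q) ^ 2
  + INR (fact q) * (Cl_prim q x - Cl_prim q 0) / x ^ S q.

Lemma is_series_zeta_term_lt_1 (q : nat) (z : R) :
  0 < z < 1 -> is_series (zeta_term q z) (zeta_value q (2 * PI * z)).
Proof.
intros Hz; assert (HPI := PI_RGT_0).
set (p := Psi q (2 * PI * z) / (2 * PI) ^ S q).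
set (d := fun K => ln (PI * z / sin (PI * z))
       - sum_n (fun k => zeta (2 * (k + 1)) * z ^ (2 * (k + 1)) / INR (k + 1)) K).
assert (Hzq : 0 < z ^ S q) by (apply pow_lt; lra).
assert (Hpq : 0 < (2 * PI) ^ S q) by (apply pow_lt; lra).
assert (HS : INR (S q) <> 0) by (apply not_0_INR; lia).
replace (zeta_value q (2 * PI * z)) with (p * / z ^ S q).
2: { unfold p, zeta_value, Psi; rewrite Rabs_pos_eq by nra; rewrite Rpow_mult_distr.
     revert Hzq Hpq; generalize (z ^ S q) ((2 * PI) ^ S q); intros; field; repeat split; lra. }
assert (Hd : is_lim_seq d 0).
{ unfold d; rewrite <- (Rminus_diag (ln (PI * z / sin (PI * z)))).
  apply is_lim_seq_minus'; [apply is_lim_seq_const|exact (is_series_zeta z Hz)]. }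
assert (H : is_lim_seq (fun K => z ^ S q * sum_n (zeta_term q z) K) p).
{ apply is_lim_seq_le_le with (fun K => p - d K) (fun _ => p).
  - intros K; assert (H := Psi_zeta_bound q K z Hz); fold p (d K) in H; lra.
  - replace (Finite p) with (Finite (p - 0)) by (f_equal; ring); apply is_lim_seq_minus'; auto; apply is_lim_seq_const.
  - apply is_lim_seq_const. }
apply is_series_lim.
apply is_lim_seq_ext with (fun K => z ^ S q * sum_n (zeta_term q z) K * / z ^ S q).
- intros K; field; lra.
- apply is_lim_seq_mult'; auto; apply is_lim_seq_const.
Qed.

Lemma is_series_zeta_term_1 (q : nat) : is_series (zeta_term q 1) (zeta_value q (2 * PI * 1)).
Proof.
assert (HPI := PI_RGT_0).
assert (Hn : forall n, 0 < 1 - / INR (n + 2) < 1).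
{ intros n; assert (H : 1 < INR (n + 2)).
  { replace (n + 2)%nat with (S (n + 1)) by lia; rewrite S_INR; generalize (INR_succ_ge_1 n); lra. }
  assert (0 < / INR (n + 2) < 1).
  { split; [apply Rinv_0_lt_compat; lra|rewrite <- Rinv_1; apply Rinv_lt_contravar; lra]. }
  lra. }
assert (Hlim : is_lim_seq (fun n => 1 - / INR (n + 2)) 1).
{ replace (Finite 1) with (Finite (1 - 0)) by (f_equal; ring).
  apply is_lim_seq_minus'; [apply is_lim_seq_const|].
  apply is_lim_seq_ext with (fun n => / INR (S n + 1)).
  { intros n; replace (S n + 1)%nat with (n + 2)%nat by lia; reflexivity. }
  apply -> (is_lim_seq_incr_1 (fun n => / INR (n + 1))); apply is_lim_seq_inv_INR. }
assert (HV : is_lim_seq (fun n => zeta_value q (2 * PI * (1 - / INR (n + 2)))) (zeta_value q (2 * PI * 1))).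
{ apply (is_lim_seq_continuous (fun z => zeta_value q (2 * PI * z))); auto.
  apply (continuity_pt_comp (fun z => 2 * PI * z) (zeta_value q)).
  - apply derivable_continuous_pt, ex_derive_Reals_0; auto_derive; auto.
  - rewrite Rmult_1_r; unfold zeta_value.
    apply (continuity_pt_plus (fun x => ln (Rabs x) / INR (S q) - / INR (S q) ^ 2)
      (fun x => INR (fact q) * (Cl_prim q x - Cl_prim q 0) / x ^ S q)).
    + generalize (INR (S q)); intros c.
      apply derivable_continuous_pt, ex_derive_Reals_0; auto_derive.
      repeat split; [lra|apply Rabs_pos_lt; lra].
    + apply (continuity_pt_mult (fun x => INR (fact q) * (Cl_prim q x - Cl_prim q 0))
                                (fun x => / x ^ S q)).
      * apply (continuity_pt_scal (fun x => Cl_prim q x - Cl_prim q 0)).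
        apply (continuity_pt_minus (Cl_prim q) (fun _ => Cl_prim q 0)).
        -- apply continuity_pt_Cl_prim.
        -- apply continuity_pt_const; intros x y; reflexivity.
      * apply (continuity_pt_inv (fun x => x ^ S q)).
        -- apply derivable_continuous_pt, derivable_pt_pow.
        -- apply pow_nonzero; lra. }
assert (Hpos : forall z k, 0 <= z -> 0 <= zeta_term q z k).
{ intros z k Hz; unfold zeta_term, Rdiv.
  repeat apply Rmult_le_pos; [apply zeta_pos; lia|apply pow_le; lra|].
  apply Rlt_le, Rinv_0_lt_compat, Rmult_lt_0_compat; apply lt_0_INR; lia. }
assert (Hmono : forall z k, 0 <= z <= 1 -> zeta_term q z k <= zeta_term q 1 k).
{ intros z k Hz; unfold zeta_term, Rdiv.
  apply Rmult_le_compat_r.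
  - apply Rlt_le, Rinv_0_lt_compat, Rmult_lt_0_compat; apply lt_0_INR; lia.
  - apply Rmult_le_compat_l; [apply zeta_pos; lia|apply pow_incr; lra]. }
assert (Hb : forall K, sum_n (zeta_term q 1) K <= zeta_value q (2 * PI * 1)).
{ intros K.
  apply (is_lim_seq_le (fun n => sum_n (zeta_term q (1 - / INR (n + 2))) K)
    (fun n => zeta_value q (2 * PI * (1 - / INR (n + 2)))) (sum_n (zeta_term q 1) K)
    (zeta_value q (2 * PI * 1))); auto.
  - intros n; apply sum_n_le_series.
    + intros k; apply Hpos; generalize (Hn n); lra.
    + apply is_series_zeta_term_lt_1, Hn.
  - apply (is_lim_seq_continuous (fun z => sum_n (zeta_term q z) K)); auto.
    apply (continuity_pt_sum_n (fun k z => zeta_term q z k)); intros k; unfold zeta_term.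
    generalize (INR (k + 1) * INR (2 * (k + 1) + S q)) (zeta (2 * (k + 1))); intros c d.
    apply derivable_continuous_pt, ex_derive_Reals_0; auto_derive; auto. }
destruct (ex_finite_lim_seq_incr (sum_n (zeta_term q 1)) (zeta_value q (2 * PI * 1))) as [l Hl]; auto.
{ intros n; rewrite sum_n_succ; generalize (Hpos 1 (S n) ltac:(lra)); lra. }
assert (l <= zeta_value q (2 * PI * 1)).
{ apply (is_lim_seq_le (sum_n (zeta_term q 1)) (fun _ => zeta_value q (2 * PI * 1)) l
    (zeta_value q (2 * PI * 1))); auto; apply is_lim_seq_const. }
assert (zeta_value q (2 * PI * 1) <= l).
{ apply (is_lim_seq_le (fun n => zeta_value q (2 * PI * (1 - / INR (n + 2)))) (fun _ => l)
    (zeta_value q (2 * PI * 1)) l); auto; [|apply is_lim_seq_const].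
  intros n; specialize (Hn n).
  apply (is_lim_seq_le (sum_n (zeta_term q (1 - / INR (n + 2)))) (sum_n (zeta_term q 1))
    (zeta_value q (2 * PI * (1 - / INR (n + 2)))) l); [|now apply is_series_zeta_term_lt_1|exact Hl].
  intros K; induction K as [|K IH]; rewrite ?sum_n_zero, ?sum_n_succ.
  - apply Hmono; lra.
  - apply Rplus_le_compat; [exact IH|apply Hmono; lra]. }
replace (zeta_value q (2 * PI * 1)) with l by lra; exact Hl.
Qed.

(** * The two closed forms *)

Lemma zeta_value_opp (q : nat) (x : R) : x <> 0 -> zeta_value q (- x) = zeta_value q x.
Proof.
intros Hx; unfold zeta_value.
assert (E0 : Cl_prim q 0 = (-1) ^ S q * Cl_prim q 0).
{ rewrite <- Cl_prim_opp, Ropp_0; reflexivity. }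
rewrite Rabs_Ropp; f_equal.
rewrite Cl_prim_opp, E0 at 1.
replace (- x) with (-1 * x) by ring; rewrite Rpow_mult_distr.
field; split; apply pow_nonzero; lra.
Qed.

Lemma is_series_zeta_term (q : nat) (z : R) :
  0 < Rabs z <= 1 -> is_series (zeta_term q z) (zeta_value q (2 * PI * z)).
Proof.
intros Hz; assert (HPI := PI_RGT_0).
assert (Hpos : forall t, 0 < t <= 1 -> is_series (zeta_term q t) (zeta_value q (2 * PI * t))).
{ intros t Ht; destruct (Req_dec t 1) as [->|H].
  - apply is_series_zeta_term_1.
  - apply is_series_zeta_term_lt_1; lra. }
destruct (Rle_dec 0 z) as [H|H].
- rewrite Rabs_pos_eq in Hz by lra; now apply Hpos.
- rewrite Rabs_left in Hz by lra.
  rewrite <- zeta_value_opp by (apply Rlt_not_eq; nra).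
  replace (- (2 * PI * z)) with (2 * PI * - z) by ring.
  apply (is_series_ext_R _ _ _ (Hpos (- z) Hz)).
  intros k; unfold zeta_term; rewrite !pow_mult.
  replace ((- z) ^ 2) with (z ^ 2) by ring; reflexivity.
Qed.

Lemma sum_n_m_1 (a : nat -> R) (n : nat) : sum_n_m a 1 (S n) = sum_n (fun j => a (S j)) n.
Proof. symmetry; exact (sum_n_m_S a 0 n). Qed.

Lemma prim_term_pair_even (m d : nat) (x : R) :
  x <> 0 ->
  let n := S (m + d) in
  prim_term (2 * n - 1) x (2 * m) + prim_term (2 * n - 1) x (S (2 * m))
  = - (x ^ (2 * n) * ((-1) ^ S m *
       ((INR (2 * n + 1 - 2 * S m) * Cl (2 * S m + 1) x + x * Cl (2 * S m) x)
        / (INR (fact (2 * n + 1 - 2 * S m)) * x ^ (2 * S m))))).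
Proof.
intros Hx n; unfold prim_term, n.
replace (2 * S (m + d) - 1 - 2 * m)%nat with (S (2 * d)) by lia.
replace (2 * S (m + d) - 1 - S (2 * m))%nat with (2 * d)%nat by lia.
replace (2 * S (m + d) + 1 - 2 * S m)%nat with (S (2 * d)) by lia.
replace (2 * S m + 1)%nat with (S (S (S (2 * m)))) by lia.
replace (2 * S (m + d))%nat with (2 * S m + 2 * d)%nat by lia.
replace (2 * S m)%nat with (S (S (2 * m))) by lia.
rewrite Nat.div2_double, Nat.div2_succ_double, fact_simpl, mult_INR, pow_add.
assert (H := pow_nonzero x (S (S (2 * m))) Hx).
assert (Hf := INR_fact_neq_0 (2 * d)).
assert (Hs : INR (S (2 * d)) <> 0) by (apply not_0_INR; lia).
revert H Hf Hs; rewrite <- (tech_pow_Rmult x (2 * d)), <- (tech_pow_Rmult (-1) m).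
generalize (x ^ S (S (2 * m))) (x ^ (2 * d)) (INR (S (2 * d))) (INR (fact (2 * d))).
intros; field; auto.
Qed.

Lemma Cl_prim_odd (n : nat) (x : R) :
  x <> 0 ->
  Cl_prim (2 * S n - 1) x
  = - (x ^ (2 * S n) * sum_n_m (fun j : nat => (-1) ^ j *
       ((INR (2 * S n + 1 - 2 * j) * Cl (2 * j + 1) x + x * Cl (2 * j) x)
        / (INR (fact (2 * S n + 1 - 2 * j)) * x ^ (2 * j)))) 1 (S n)).
Proof.
intros Hx; rewrite sum_n_m_1; unfold Cl_prim.
assert (H : forall m, (m <= n)%nat ->
  sum_n (prim_term (2 * S n - 1) x) (S (2 * m))
  = - (x ^ (2 * S n) * sum_n (fun j : nat => (-1) ^ S j *
       ((INR (2 * S n + 1 - 2 * S j) * Cl (2 * S j + 1) x + x * Cl (2 * S j) x)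
        / (INR (fact (2 * S n + 1 - 2 * S j)) * x ^ (2 * S j)))) m) :> R).
{ induction m as [|m IH]; intros Hm.
  - rewrite sum_n_succ, !sum_n_zero.
    apply (prim_term_pair_even 0 n x Hx).
  - replace (2 * S m)%nat with (S (S (2 * m))) at 1 by lia.
    rewrite sum_n_succ, (sum_n_succ _ (S (2 * m))), IH by lia.
    rewrite sum_n_succ, Rmult_plus_distr_l, Ropp_plus_distr, Rplus_assoc.
    apply f_equal.
    assert (E := prim_term_pair_even (S m) (n - S m) x Hx); cbv zeta in E.
    replace (S (S m + (n - S m))) with (S n) in E by lia.
    rewrite <- E; replace (2 * S m)%nat with (S (S (2 * m))) by lia; reflexivity. }
rewrite <- (H n (le_n n)); f_equal; lia.
Qed.

Lemma prim_term_pair_odd (m d : nat) (x : R) :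
  x <> 0 ->
  let n := S (S m + d) in
  prim_term (2 * n - 2) x (S (2 * m)) + prim_term (2 * n - 2) x (S (S (2 * m)))
  = - (x ^ (2 * n - 1) * ((-1) ^ S (S m) *
       ((INR (2 * n + 1 - 2 * S (S m)) * Cl (2 * S (S m)) x - x * Cl (2 * S (S m) - 1) x)
        / (INR (fact (2 * n + 1 - 2 * S (S m))) * x ^ (2 * S (S m) - 1))))).
Proof.
intros Hx n; unfold prim_term, n.
replace (2 * S (S m + d) - 2 - S (2 * m))%nat with (S (2 * d)) by lia.
replace (2 * S (S m + d) - 2 - S (S (2 * m)))%nat with (2 * d)%nat by lia.
replace (2 * S (S m + d) + 1 - 2 * S (S m))%nat with (S (2 * d)) by lia.
replace (2 * S (S m) - 1)%nat with (S (S (S (2 * m)))) by lia.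
replace (2 * S (S m + d) - 1)%nat with (S (S (S (2 * m))) + 2 * d)%nat by lia.
replace (2 * S (S m))%nat with (S (S (S (S (2 * m))))) by lia.
change (Nat.div2 (S (S (2 * m)))) with (S (Nat.div2 (2 * m))).
rewrite Nat.div2_double, Nat.div2_succ_double, fact_simpl, mult_INR, pow_add.
assert (H := pow_nonzero x (S (S (S (2 * m)))) Hx).
assert (Hf := INR_fact_neq_0 (2 * d)).
assert (Hs : INR (S (2 * d)) <> 0) by (apply not_0_INR; lia).
revert H Hf Hs; rewrite <- (tech_pow_Rmult x (2 * d)).
rewrite <- (tech_pow_Rmult (-1) (S m)), <- (tech_pow_Rmult (-1) m).
generalize (x ^ S (S (S (2 * m)))) (x ^ (2 * d)) (INR (S (2 * d))) (INR (fact (2 * d))).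
intros; field; auto.
Qed.

Lemma Cl_prim_even (n : nat) (x : R) :
  x <> 0 ->
  Cl_prim (2 * S n - 2) x
  = x ^ (2 * S n - 1) * (Cl 1 x / INR (fact (2 * S n - 1))
    - sum_n_m (fun j : nat => (-1) ^ j *
       ((INR (2 * S n + 1 - 2 * j) * Cl (2 * j) x - x * Cl (2 * j - 1) x)
        / (INR (fact (2 * S n + 1 - 2 * j)) * x ^ (2 * j - 1)))) 1 (S n)).
Proof.
intros Hx; rewrite sum_n_m_1; unfold Cl_prim.
assert (H : forall m, (m <= n)%nat ->
  sum_n (prim_term (2 * S n - 2) x) (2 * m)
  = x ^ (2 * S n - 1) * (Cl 1 x / INR (fact (2 * S n - 1))
    - sum_n (fun j : nat => (-1) ^ S j *
       ((INR (2 * S n + 1 - 2 * S j) * Cl (2 * S j) x - x * Cl (2 * S j - 1) x)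
        / (INR (fact (2 * S n + 1 - 2 * S j)) * x ^ (2 * S j - 1)))) m) :> R).
{ induction m as [|m IH]; intros Hm.
  - simpl (2 * 0)%nat; rewrite !sum_n_zero; unfold prim_term.
    replace (2 * 1 - 1)%nat with 1%nat by lia.
    replace (2 * 1)%nat with 2%nat by lia.
    replace (2 * S n - 2 - 0)%nat with (2 * n)%nat by lia.
    replace (2 * S n + 1 - 2)%nat with (S (2 * n)) by lia.
    replace (2 * S n - 1)%nat with (S (2 * n)) by lia.
    rewrite fact_simpl, mult_INR, <- tech_pow_Rmult; simpl Nat.div2.
    assert (Hf := INR_fact_neq_0 (2 * n)).
    assert (Hs : INR (S (2 * n)) <> 0) by (apply not_0_INR; lia).
    revert Hf Hs; generalize (INR (S (2 * n))) (INR (fact (2 * n))).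
    intros; field; auto.
  - replace (2 * S m)%nat with (S (S (2 * m))) at 1 by lia.
    rewrite sum_n_succ, (sum_n_succ _ (2 * m)), IH by lia.
    rewrite (sum_n_succ _ m), Rplus_assoc.
    assert (E := prim_term_pair_odd m (n - S m) x Hx); cbv zeta in E.
    replace (S (S m + (n - S m))) with (S n) in E by lia.
    rewrite E; ring. }
rewrite <- (H n (le_n n)); f_equal; lia.
Qed.

Lemma Cl_odd_0 (n : nat) : Cl (S (2 * S n)) 0 = zeta (2 * S n + 1).
Proof.
replace (2 * S n + 1)%nat with (S (2 * S n)) by lia.
replace (2 * S n)%nat with (S (2 * n + 1)) by lia.
rewrite Cl_trig; apply Series_ext; intros k.
unfold trig; rewrite Nat.even_odd, Rmult_0_r, cos_0; unfold Rdiv; ring.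
Qed.

Lemma Cl_even_0 (n : nat) : Cl (2 * S n) 0 = 0.
Proof.
replace (2 * S n)%nat with (S (S (2 * n))) by lia.
assert (E := Cl_opp (2 * n) 0); rewrite Ropp_0, pow_1_odd in E; lra.
Qed.

Theorem theorem2 (n : nat) (z : R) :
  (1 <= n)%nat ->
  0 < Rabs z <= 1 ->
  is_series
    (fun k : nat => zeta (2 * (k + 1)) * z ^ (2 * (k + 1))
                    / (INR (k + 1) * INR (k + 1 + n)))
    ( - / (2 * INR n ^ 2)
      + ln (Rabs (2 * PI * z)) / INR n
      + (-1) ^ n * 2 * INR (fact (2 * n - 1)) / (2 * PI * z) ^ (2 * n)
          * zeta (2 * n + 1)
      - 2 * INR (fact (2 * n - 1)) *
          sum_n_m (fun j : nat =>
            (-1) ^ j *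
            ((INR (2 * n + 1 - 2 * j) * Cl (2 * j + 1) (2 * PI * z)
              + 2 * PI * z * Cl (2 * j) (2 * PI * z))
             / (INR (fact (2 * n + 1 - 2 * j)) * (2 * PI * z) ^ (2 * j))))
          1 n)
  /\
  (Rabs z < 1 ->
   is_series
    (fun k : nat => zeta (2 * (k + 1)) * z ^ (2 * (k + 1))
                    / (INR (k + 1) * INR (2 * (k + 1) - 1 + 2 * n)))
    ( - / (INR (2 * n - 1)) ^ 2
      + ln (PI * z * / sin (PI * z)) / INR (2 * n - 1)
      - INR (fact (2 * n - 2)) *
          sum_n_m (fun j : nat =>
            (-1) ^ j *
            ((INR (2 * n + 1 - 2 * j) * Cl (2 * j) (2 * PI * z)
              - 2 * PI * z * Cl (2 * j - 1) (2 * PI * z))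
             / (INR (fact (2 * n + 1 - 2 * j)) * (2 * PI * z) ^ (2 * j - 1))))
          1 n)).
Proof.
intros Hn Hz; assert (HPI := PI_RGT_0).
destruct n as [|n]; [lia|].
assert (Hz0 : z <> 0) by (intros ->; rewrite Rabs_R0 in Hz; lra).
assert (Hx : 2 * PI * z <> 0) by (apply Rmult_integral_contrapositive_currified; lra).
split.
- assert (H := is_series_scal_R 2 _ _
    (is_series_zeta_term (2 * S n - 1) z Hz)).
  match type of H with is_series _ ?v =>
    match goal with |- is_series _ ?w => replace w with v end end.
  + apply (is_series_ext_R _ _ _ H); intros k; unfold zeta_term.
    replace (2 * (k + 1) + S (2 * S n - 1))%nat with (2 * (k + 1 + S n))%nat by lia.
    rewrite (mult_INR 2 (k + 1 + S n)); simpl (INR 2).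
    assert (H1 : INR (k + 1) <> 0) by (apply not_0_INR; lia).
    assert (H2 : INR (k + 1 + S n) <> 0) by (apply not_0_INR; lia).
    field; auto.
  + unfold zeta_value.
    rewrite Cl_prim_odd by auto; rewrite Cl_prim_0.
    replace (S (2 * S n - 1)) with (2 * S n)%nat by lia.
    rewrite Cl_odd_0.
    replace (2 * S n - 1)%nat with (S (2 * n)) by lia; rewrite Nat.div2_succ_double.
    rewrite (mult_INR 2 (S n)), <- (tech_pow_Rmult (-1) n); simpl (INR 2).
    assert (Hp := pow_nonzero (2 * PI * z) (2 * S n) Hx).
    assert (HS : INR (S n) <> 0) by (apply not_0_INR; lia).
    revert Hp HS; generalize ((2 * PI * z) ^ (2 * S n)) (INR (S n)).
    match goal with |- context [sum_n_m ?f 1 (S n)] => generalize (sum_n_m f 1 (S n)) end.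
    intros; field; auto.
- intros Hz1.
  assert (H := is_series_zeta_term (2 * S n - 2) z Hz).
  match type of H with is_series _ ?v =>
    match goal with |- is_series _ ?w => replace w with v end end.
  + apply (is_series_ext_R _ _ _ H); intros k; unfold zeta_term.
    replace (2 * (k + 1) + S (2 * S n - 2))%nat with (2 * (k + 1) - 1 + 2 * S n)%nat by lia.
    reflexivity.
  + assert (Hln : ln (PI * z * / sin (PI * z)) = ln (Rabs (2 * PI * z)) + Cl 1 (2 * PI * z)).
    { assert (Habs := ln_plus_Cl_1 (Rabs z) (conj (proj1 Hz) Hz1)).
      destruct (Rle_dec 0 z) as [Hz2|Hz2].
      - rewrite Rabs_pos_eq in Habs by lra.
        rewrite Rabs_pos_eq by (apply Rmult_le_pos; lra).
        symmetry; exact Habs.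
      - rewrite Rabs_left in Habs by lra.
        replace (PI * z * / sin (PI * z)) with (PI * - z / sin (PI * - z)).
        2: { rewrite Ropp_mult_distr_r_reverse, sin_neg; unfold Rdiv.
             rewrite Rinv_opp; ring. }
        assert (0 < PI * - z) by (apply Rmult_lt_0_compat; lra).
        rewrite <- Habs, Rabs_left by lra; f_equal.
        + f_equal; ring.
        + unfold Cl; replace (2 * PI * - z / 2) with (- (2 * PI * z / 2)) by field.
          rewrite sin_neg, Ropp_mult_distr_r_reverse, Rabs_Ropp; reflexivity. }
    rewrite Hln; unfold zeta_value.
    rewrite Cl_prim_even by auto; rewrite Cl_prim_0.
    replace (S (S (2 * S n - 2))) with (2 * S n)%nat by lia.
    rewrite Cl_even_0.
    replace (S (2 * S n - 2)) with (2 * S n - 1)%nat by lia.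
    replace (fact (2 * S n - 1)) with ((2 * S n - 1) * fact (2 * S n - 2))%nat.
    2: { replace (2 * S n - 1)%nat with (S (2 * S n - 2)) by lia; now rewrite fact_simpl. }
    rewrite mult_INR.
    assert (Hp := pow_nonzero (2 * PI * z) (2 * S n - 1) Hx).
    assert (HS : INR (2 * S n - 1) <> 0) by (apply not_0_INR; lia).
    assert (Hf := INR_fact_neq_0 (2 * S n - 2)).
    revert Hp HS Hf.
    generalize ((2 * PI * z) ^ (2 * S n - 1)) (INR (2 * S n - 1)) (INR (fact (2 * S n - 2))).
    match goal with |- context [sum_n_m ?f 1 (S n)] => generalize (sum_n_m f 1 (S n)) end.
    intros; field; auto.
Qed.
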